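(* Consider $\dot x=f(t,x,u)$, $t\in J$. Assume there exist a $C^1$ function $V:J\times\mathbb{R}^n\to[0,\infty)$, $\alpha_1,\alpha_2\in\mathcal K_\infty$, $\rho\in\mathcal K$, and a uniformly exponentially stable function $\mu\in\mathbb{PC}(J,\mathbb{R})$ such that for all $(t,x)\in J\times\mathbb{R}^n$, $\alpha_1(|x|)\le V(t,x)\le\alpha_2(|x|)$, and for all $(t,x,u)\in J\times\mathbb{R}^n\times\mathbb{R}^m$ with $V(t,x)\ge\rho(|u|)$, $$\frac{\partial V}{\partial t}(t,x)+\frac{\partial V}{\partial x}(t,x)f(t,x,u)\le\mu(t)V(t,x).$$ Then the system is input-to-state stable: there exist $\sigma\in\mathcal{KL}$ and $\gamma_1\in\mathcal K$ such that for every locally essentially bounded input $u$ and every initial state, $|x(t)|\le\sigma(|x(t_0)|,t-t_0)+\gamma_1(\|u\|_{[t_0,t]})$ for all $t\ge t_0\in J$.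
   Context: $J=[t^{\#},\infty)$; $f:J\times\mathbb{R}^n\times\mathbb{R}^m\to\mathbb{R}^n$ continuous, locally Lipschitz in $x$ for bounded $u$, $f(t,0,0)=0$; inputs $u:J\to\mathbb{R}^m$ are locally essentially bounded, and $\|u\|_{[t_0,t]}=\sup\{|u(s)|:s\in[t_0,t]\}$. Class $\mathcal K$: $\alpha:[0,\infty)\to[0,\infty)$ continuous, nondecreasing, $\alpha(0)=0$; class $\mathcal K_\infty$: continuous, strictly increasing, $\alpha(0)=0$, unbounded; class $\mathcal{KL}$: $\sigma(\cdot,t)\in\mathcal K$ for each $t$, $\sigma(s,\cdot)$ nonincreasing and tending to $0$. $\mu\in\mathbb{PC}(J,\mathbb{R})$ (piecewise continuous) is uniformly exponentially stable if there exist $\alpha>0$, $\beta\ge0$ with $\int_{t_0}^t\mu(s)ds\le-\alpha(t-t_0)+\beta$ for all $t\ge t_0\in J$. *)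

(* Defs.v *)
From Stdlib Require Import Reals List.
From Stdlib Require Fin.
Open Scope R_scope.

Definition vec (n : nat) : Type := Fin.t n -> R.

Fixpoint finsum (n : nat) : (Fin.t n -> R) -> R :=
  match n return (Fin.t n -> R) -> R with
  | O => fun _ => 0
  | S k => fun g => g Fin.F1 + finsum k (fun i => g (Fin.FS i))
  end.

Definition vzero {n : nat} : vec n := fun _ => 0.
Definition vadd {n : nat} (x y : vec n) : vec n := fun i => x i + y i.
Definition vsub {n : nat} (x y : vec n) : vec n := fun i => x i - y i.
Definition dot {n : nat} (x y : vec n) : R := finsum n (fun i => x i * y i).
Definition norm {n : nat} (x : vec n) : R := sqrt (dot x x).

Definition inJ (tsharp t : R) : Prop := tsharp <= t.

Definition cont_nonneg (a : R -> R) : Prop :=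
  forall s, 0 <= s -> forall eps, 0 < eps -> exists delta, 0 < delta /\
    forall s', 0 <= s' -> Rabs (s' - s) < delta -> Rabs (a s' - a s) < eps.

Definition classK (a : R -> R) : Prop :=
  cont_nonneg a /\
  (forall s, 0 <= s -> 0 <= a s) /\
  (forall s s', 0 <= s -> s <= s' -> a s <= a s') /\
  a 0 = 0.

Definition classKinf (a : R -> R) : Prop :=
  cont_nonneg a /\
  (forall s, 0 <= s -> 0 <= a s) /\
  (forall s s', 0 <= s -> s < s' -> a s < a s') /\
  a 0 = 0 /\
  (forall M, exists s, 0 <= s /\ M < a s).

Definition classKL (sg : R -> R -> R) : Prop :=
  (forall t, 0 <= t -> classK (fun s => sg s t)) /\
  (forall s t t', 0 <= s -> 0 <= t -> t <= t' -> sg s t' <= sg s t) /\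
  (forall s, 0 <= s -> forall eps, 0 < eps -> exists T, 0 <= T /\
     forall t, T <= t -> Rabs (sg s t) < eps).

Definition piecewise_continuous (tsharp : R) (mu : R -> R) : Prop :=
  forall a b, tsharp <= a -> a <= b ->
  exists l : list R,
    (forall t, a <= t <= b -> ~ In t l ->
       forall eps, 0 < eps -> exists delta, 0 < delta /\
         forall s, a <= s <= b -> Rabs (s - t) < delta -> Rabs (mu s - mu t) < eps) /\
    (forall p, In p l ->
       (a < p -> exists L, forall eps, 0 < eps -> exists delta, 0 < delta /\
          forall s, a <= s < p -> p - s < delta -> Rabs (mu s - L) < eps) /\
       (p < b -> exists L, forall eps, 0 < eps -> exists delta, 0 < delta /\
          forall s, p < s <= b -> s - p < delta -> Rabs (mu s - L) < eps)).

Definition UES (tsharp : R) (mu : R -> R) : Prop :=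
  exists alpha beta, 0 < alpha /\ 0 <= beta /\
    forall t0 t (pr : Riemann_integrable mu t0 t),
      inJ tsharp t0 -> t0 <= t -> RiemannInt pr <= - alpha * (t - t0) + beta.

(** V is C^1 on J x R^n with partial derivatives Vt (in t) and Vx (gradient in x);
    at t = tsharp the t-derivative is one-sided. *)
Definition C1_with_partials (tsharp : R) {n : nat} (V : R -> vec n -> R)
  (Vt : R -> vec n -> R) (Vx : R -> vec n -> vec n) : Prop :=
  forall t x, inJ tsharp t ->
    (forall eps, 0 < eps -> exists delta, 0 < delta /\
       forall h (k : vec n), inJ tsharp (t + h) -> Rabs h < delta -> norm k < delta ->
         Rabs (V (t + h) (vadd x k) - V t x - Vt t x * h - dot (Vx t x) k)
           <= eps * (Rabs h + norm k)) /\
    (forall eps, 0 < eps -> exists delta, 0 < delta /\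
       forall t' (x' : vec n), inJ tsharp t' -> Rabs (t' - t) < delta ->
         norm (vsub x' x) < delta ->
         Rabs (Vt t' x' - Vt t x) < eps /\ norm (vsub (Vx t' x') (Vx t x)) < eps).

Definition f_continuous (tsharp : R) {n m : nat} (f : R -> vec n -> vec m -> vec n) : Prop :=
  forall t x u, inJ tsharp t -> forall eps, 0 < eps -> exists delta, 0 < delta /\
    forall t' x' u', inJ tsharp t' -> Rabs (t' - t) < delta ->
      norm (vsub x' x) < delta -> norm (vsub u' u) < delta ->
      norm (vsub (f t' x' u') (f t x u)) < eps.

Definition f_loc_lipschitz (tsharp : R) {n m : nat} (f : R -> vec n -> vec m -> vec n) : Prop :=
  forall b r M, exists L, forall t (x y : vec n) (u : vec m),
    tsharp <= t <= b -> norm x <= r -> norm y <= r -> norm u <= M ->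
    norm (vsub (f t x u) (f t y u)) <= L * norm (vsub x y).

Definition f_zero (tsharp : R) {n m : nat} (f : R -> vec n -> vec m -> vec n) : Prop :=
  forall t, inJ tsharp t -> forall i, f t vzero vzero i = 0.

Definition outer_le (E : R -> Prop) (eps : R) : Prop :=
  exists a b : nat -> R, (forall k, a k <= b k) /\
    (forall t, E t -> exists k, a k < t < b k) /\
    (forall K, sum_f_R0 (fun k => b k - a k) K <= eps).

Definition null_set (E : R -> Prop) : Prop :=
  forall eps, 0 < eps -> outer_le E eps.

Definition ae_on (S P : R -> Prop) : Prop :=
  exists N, null_set N /\ forall t, S t -> ~ N t -> P t.

Definition open_R (G : R -> Prop) : Prop :=
  forall t, G t -> exists delta, 0 < delta /\ forall s, Rabs (s - t) < delta -> G s.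

Definition measurable_set (E : R -> Prop) : Prop :=
  forall eps, 0 < eps -> exists G, open_R G /\ (forall t, E t -> G t) /\
    outer_le (fun t => G t /\ ~ E t) eps.

Definition open_vec {m : nat} (O : vec m -> Prop) : Prop :=
  forall v, O v -> exists delta, 0 < delta /\ forall w, norm (vsub w v) < delta -> O w.

Definition input_measurable (tsharp : R) {m : nat} (u : R -> vec m) : Prop :=
  forall O : vec m -> Prop, open_vec O ->
    measurable_set (fun t => inJ tsharp t /\ O (u t)).

Definition loc_ess_bounded (tsharp : R) {m : nat} (u : R -> vec m) : Prop :=
  forall b, exists M, ae_on (fun t => tsharp <= t <= b) (fun t => norm (u t) <= M).

Definition admissible_input (tsharp : R) {m : nat} (u : R -> vec m) : Prop :=
  input_measurable tsharp u /\ loc_ess_bounded tsharp u.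

Fixpoint nonoverlap (l : list (R * R)) : Prop :=
  match l with
  | nil => True
  | p :: l' => (forall q, In q l' -> snd p <= fst q) /\ nonoverlap l'
  end.

Definition abs_continuous {n : nat} (x : R -> vec n) (a b : R) : Prop :=
  forall eps, 0 < eps -> exists delta, 0 < delta /\
    forall l : list (R * R),
      (forall p, In p l -> a <= fst p /\ fst p <= snd p /\ snd p <= b) ->
      nonoverlap l ->
      fold_right (fun p s => snd p - fst p + s) 0 l < delta ->
      fold_right (fun p s => norm (vsub (x (snd p)) (x (fst p))) + s) 0 l < eps.

Definition is_solution (tsharp : R) {n m : nat} (f : R -> vec n -> vec m -> vec n)
  (u : R -> vec m) (x : R -> vec n) (t0 T : R) : Prop :=
  inJ tsharp t0 /\ t0 < T /\
  (forall b, t0 <= b < T -> abs_continuous x t0 b) /\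
  ae_on (fun t => t0 <= t < T)
    (fun t => forall i, derivable_pt_lim (fun s => x s i) t (f t (x t) (u t) i)).

(* Main.v *)
(* Along a solution, W(t) = V(t, x(t)) satisfies W' <= mu W at almost every time at which
   W(t) >= rho(M), M being a bound of the input. After the last time s <= t at which W <= rho(M)
   (or after t0), W(t) exp(- int_s^t mu) is therefore nonincreasing, and exponential stability of mu
   gives W(t) <= exp(beta - alpha (t - t0)) W(t0) + exp(beta) rho(M). Applying the inverse of a1
   yields sigma and gamma1.
   That a function with nonpositive derivative almost everywhere decreases is proved with a Cousin
   partition: W need not be shown absolutely continuous, since at each tag its increments are
   controlled by those of x with a constant that is uniform along the trajectory.
   For forward completeness the state is truncated coordinatewise at a radius r(t) which exceeds by
   at least one the a priori bound given by the estimate; the truncated field is Lipschitz in the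
   state on compact time intervals, so Picard iteration gives a global solution, and the estimate
   shows that the truncation is never active. The only input from Lebesgue theory is that
   t |-> F(t, u(t)) with F continuous has a locally Lipschitz primitive. *)

From Coquelicot Require Import Coquelicot.
From mathcomp Require all_boot all_order all_algebra.
From mathcomp Require all_classical all_reals all_analysis measurable_realfun Rstruct Rstruct_topology.
Require Import Defs.
From Stdlib Require Import ZArith Reals List Lra Lia.
From Stdlib Require Import Classical FunctionalExtensionality ClassicalEpsilon.
Open Scope R_scope.

(** * Monotonicity from a sign condition almost everywhere *)

(** The dissipation inequality concerns [f], not the truncated field, so a trajectory produced by
    Picard iteration is known to obey the estimate only as long as it has stayed inside the radius.
    This is what the margin of one is for: at an exit there would be a time where [norm x - r]
    exceeds [-1] although the truncation was inactive before it, and there the estimate gives at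
    most [-1]. As inputs are only essentially bounded, with a bound that may grow from one time
    interval to the next, the radius must follow these bounds, yet continuously, since otherwise the
    truncated field would lose its continuity in time. Null and measurable sets are given by covers
    with open intervals. The monotonicity argument works directly with such covers; for primitives
    they are matched with Lebesgue measure, and the input is replaced by a Borel function equal to
    it almost everywhere. The factor [2] in [sigma] and [gamma] arises where the inverse [g] of [a1]
    is split at a sum, [g (p + q) <= g (2 * p) + g (2 * q)]. *)

(** The supremum [m] of the points reached from [a] is itself reached, by the local hypothesis at
    [m], and the same hypothesis passes beyond it unless [m = b]. Taking for [Q] the boundedness on
    an interval gives compactness arguments; taking the existence of a suitable list of pieces gives
    tagged partitions. *)
Lemma cousin (Q : R -> R -> Prop) (a b : R) : a <= b ->
  (forall r s t, r <= s -> s <= t -> Q r s -> Q s t -> Q r t) ->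
  (forall t, a <= t <= b -> exists d, 0 < d /\
     forall r s, a <= r -> r <= t -> t <= s -> s <= b -> s - r < d -> Q r s) ->
  Q a b.
Proof.
intros Hab Hadd Hloc.
set (E := fun t => a <= t <= b /\ Q a t).
assert (Ea : E a).
{ split; [lra|]. destruct (Hloc a) as [d [Hd H]]; [lra|]. apply H; lra. }
destruct (completeness E) as [m [Hub Hlub]].
{ exists b; intros t [Ht _]; lra. }
{ now exists a. }
assert (Ham : a <= m) by now apply Hub.
assert (Hmb : m <= b) by (apply Hlub; intros t [Ht _]; lra).
destruct (Hloc m) as [d [Hd H]]; [lra|].
assert (Hex : exists t, E t /\ m - d / 2 < t).
{ apply NNPP; intros Hn.
  assert (m <= m - d / 2); [|lra].
  apply Hlub; intros t Et. apply Rnot_lt_le; intros Hlt; apply Hn; now exists t. }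
destruct Hex as [t [[Ht HQt] Htm]].
assert (t <= m) by (apply Hub; now split).
(* As [t] is within [d / 2] of [m], the interval from [t] to [m'] contains [m] and is shorter than
   [d]. Since [m'] is then reached, [m' <= m], which forces [m' = b]. *)
remember (Rmin b (m + d / 4)) as m' eqn:Em.
assert (m <= m') by (subst m'; apply Rmin_glb; lra).
assert (m' <= b) by (subst m'; apply Rmin_l).
assert (m' <= m + d / 4) by (subst m'; apply Rmin_r).
assert (Em' : Q a m').
{ apply (Hadd a t m'); [lra|lra|exact HQt|]. apply H; [lra|lra|lra|lra|lra]. }
assert (m' <= m) by (apply Hub; split; [lra|auto]).
assert (m' = b).
{ revert Em. unfold Rmin. destruct Rle_dec; lra. }
now rewrite H5 in Em'.
Qed.

Lemma nonoverlap_app (l1 l2 : list (R * R)) (s : R) :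
  nonoverlap l1 -> nonoverlap l2 ->
  (forall p, In p l1 -> snd p <= s) -> (forall p, In p l2 -> s <= fst p) ->
  nonoverlap (l1 ++ l2).
Proof.
induction l1 as [|p l1 IH]; simpl; auto.
intros [Hp H1] H2 Hl Hr; split.
- intros q Hq. apply in_app_or in Hq. destruct Hq as [Hq|Hq]; auto.
  apply Rle_trans with s; auto.
- apply IH; auto.
Qed.

Lemma finsum_ext n (a b : Fin.t n -> R) : (forall i, a i = b i) -> finsum n a = finsum n b.
Proof. intros H; f_equal; now apply functional_extensionality. Qed.

Lemma norm_vsub_sym n (x y : vec n) : norm (vsub x y) = norm (vsub y x).
Proof. unfold norm, dot, vsub; f_equal; apply finsum_ext; intros i; ring. Qed.

Definition clamp (lo hi t : R) : R := Rmax lo (Rmin hi t).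

Lemma clamp_bounds lo hi t : lo <= hi -> lo <= clamp lo hi t <= hi.
Proof. unfold clamp, Rmax, Rmin; repeat destruct Rle_dec; lra. Qed.

Lemma clamp_id lo hi t : lo <= t <= hi -> clamp lo hi t = t.
Proof. unfold clamp, Rmax, Rmin; repeat destruct Rle_dec; lra. Qed.

Lemma clamp_mono lo hi s t : s <= t -> clamp lo hi s <= clamp lo hi t.
Proof. unfold clamp, Rmax, Rmin; repeat destruct Rle_dec; lra. Qed.

Lemma clamp_lip lo hi s t : Rabs (clamp lo hi s - clamp lo hi t) <= Rabs (s - t).
Proof.
unfold clamp, Rmax, Rmin; repeat destruct Rle_dec; unfold Rabs; repeat destruct Rcase_abs; lra.
Qed.

(** Convertible with the [fold_right] sums in [abs_continuous], so that [change] passes from one to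
    the other. *)
Definition sum_list {A : Type} (w : A -> R) (l : list A) : R :=
  fold_right (fun p s => w p + s) 0 l.

Lemma sum_list_app {A} (w : A -> R) l1 l2 :
  sum_list w (l1 ++ l2) = sum_list w l1 + sum_list w l2.
Proof. induction l1 as [|p l1 IH]; simpl; [|rewrite IH]; ring. Qed.

Lemma sum_list_sum_swap {A} (w : nat -> A -> R) l K :
  sum_list (fun p => sum_f_R0 (fun k => w k p) K) l =
  sum_f_R0 (fun k => sum_list (w k) l) K.
Proof.
induction K as [|K IH]; simpl.
- reflexivity.
- rewrite <- IH. clear IH. induction l as [|p l IH]; simpl; [|rewrite IH]; ring.
Qed.

(** Telescoping with gaps: the left end [r] moves along in the induction, and monotonicity of [phi]
    absorbs the gap before the next piece. *)
Lemma sum_list_monotone_increments (phi : R -> R) (l : list (R * R)) (r hi : R) :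
  (forall s t, s <= t -> phi s <= phi t) -> (forall t, phi t <= hi) ->
  (forall p, In p l -> r <= fst p /\ fst p <= snd p) -> nonoverlap l ->
  sum_list (fun p => phi (snd p) - phi (fst p)) l <= hi - phi r.
Proof.
intros Hm Hhi. revert r. induction l as [|p l IH]; intros r Hl Hno; simpl.
- generalize (Hhi r); lra.
- destruct Hno as [Hp Hno]. destruct (Hl p) as [H1 H2]; [now left|].
  assert (IH' := IH (snd p)).
  assert (phi r <= phi (fst p)) by auto.
  assert (sum_list (fun p => phi (snd p) - phi (fst p)) l <= hi - phi (snd p)).
  { apply IH'; auto. intros q Hq; split; auto. apply Hl; now right. }
  lra.
Qed.

Lemma list_index_bound {A} (P : A -> nat -> Prop) (l : list A) :
  (forall p, In p l -> exists k, P p k) ->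
  exists K, forall p, In p l -> exists k, (k <= K)%nat /\ P p k.
Proof.
induction l as [|p l IH]; intros H.
- exists 0%nat; intros p [].
- destruct IH as [K HK]; [intros; apply H; now right|].
  destruct (H p) as [k Hk]; [now left|].
  exists (Nat.max k K); intros q [<-|Hq].
  + exists k; split; auto; lia.
  + destruct (HK q Hq) as [k' [Hk' HP]]; exists k'; split; auto; lia.
Qed.

Lemma sum_f_R0_ge_term (w : nat -> R) (k K : nat) :
  (forall j, 0 <= w j) -> (k <= K)%nat -> w k <= sum_f_R0 w K.
Proof.
intros Hw. induction K as [|K IH]; intros Hk; simpl.
- replace k with 0%nat by lia; lra.
- destruct (Nat.eq_dec k (S K)) as [->|Hne].
  + generalize (cond_pos_sum w K Hw); lra.
  + assert (w k <= sum_f_R0 w K) by (apply IH; lia). generalize (Hw (S K)); lra.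
Qed.

Lemma sum_list_le {A} (w w' : A -> R) l :
  (forall p, In p l -> w p <= w' p) -> sum_list w l <= sum_list w' l.
Proof.
induction l as [|p l IH]; intros H; simpl; [lra|].
apply Rplus_le_compat; [apply H; now left|apply IH; intros; apply H; now right].
Qed.

(** The function [clamp (a k) (b k)] increases by the full length over a piece inside the [k]-th
    interval, but by at most [b k - a k] over all pieces together. Exchanging the two finite sums
    therefore compares lengths without measure theory. *)
Lemma total_length_le_cover (a b : nat -> R) (l : list (R * R)) (lo e : R) :
  (forall k, a k <= b k) -> (forall K, sum_f_R0 (fun k => b k - a k) K <= e) ->
  (forall p, In p l -> lo <= fst p /\ fst p <= snd p) -> nonoverlap l ->
  (forall p, In p l -> exists k, a k <= fst p /\ snd p <= b k) ->
  sum_list (fun p => snd p - fst p) l <= e.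
Proof.
intros Hab Hsum Hl Hno Hcov.
destruct (list_index_bound (fun p k => a k <= fst p /\ snd p <= b k) l Hcov) as [K HK].
apply Rle_trans with (sum_f_R0 (fun k => b k - a k) K); [|apply Hsum].
set (phi := fun k t => clamp (a k) (b k) t).
apply Rle_trans with
  (sum_list (fun p => sum_f_R0 (fun k => phi k (snd p) - phi k (fst p)) K) l).
- apply sum_list_le; intros p Hp.
  destruct (HK p Hp) as [k [Hk [H1 H2]]]. destruct (Hl p Hp) as [H3 H4].
  replace (snd p - fst p) with (phi k (snd p) - phi k (fst p))
    by (unfold phi; rewrite !clamp_id; lra).
  apply (sum_f_R0_ge_term (fun k => phi k (snd p) - phi k (fst p))); auto.
  intros j. assert (phi j (fst p) <= phi j (snd p)) by now apply clamp_mono. lra.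
- rewrite (sum_list_sum_swap (fun k p => phi k (snd p) - phi k (fst p))).
  apply sum_Rle; intros k _.
  apply Rle_trans with (b k - phi k lo).
  + apply sum_list_monotone_increments; auto.
    * intros; now apply clamp_mono.
    * intros; now apply clamp_bounds.
  + generalize (clamp_bounds (a k) (b k) lo (Hab k)); unfold phi; lra.
Qed.

(* Cousin partition: a piece tagged outside [N] costs slope [e]; a piece tagged in [N] is cut at
   its tag and both halves go into the list whose total length the cover of [N] controls. *)
Lemma ae_monotone {n : nat} (x : R -> vec n) (g : R -> R) (N : R -> Prop) (a b C : R) :
  a <= b -> 0 <= C -> abs_continuous x a b -> null_set N ->
  (forall t, a <= t <= b -> exists d, 0 < d /\ forall s, a <= s <= b -> Rabs (s - t) < d ->
     Rabs (g s - g t) <= C * (Rabs (s - t) + norm (vsub (x s) (x t)))) ->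
  (forall t, a <= t <= b -> ~ N t -> forall e, 0 < e -> exists d, 0 < d /\
     forall s, a <= s <= b -> Rabs (s - t) < d ->
       (t <= s -> g s - g t <= e * (s - t)) /\ (s <= t -> g t - g s <= e * (t - s))) ->
  g b <= g a.
Proof.
intros Hab HC Hac HN Hlip Hder.
assert (Hkey : forall e, 0 < e -> g b - g a <= e * (b - a) + 2 * C * e).
{ intros e He.
  destruct (Hac e He) as [d0 [Hd0 Hac']].
  (* Bound for the total length of the cut pieces: below [d0], so that absolute continuity applies
     to them, and at most [e], so that lengths and increments together cost at most [2 * C * e]. *)
  set (d1 := Rmin (d0 / 2) e).
  assert (Hd1 : 0 < d1) by (unfold d1; apply Rmin_glb_lt; lra).
  assert (Hd1a : d1 <= d0 / 2) by apply Rmin_l.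
  assert (Hd1b : d1 <= e) by apply Rmin_r.
  destruct (HN d1 Hd1) as [ca [cb [Hc [Hcov Hsum]]]].
  set (len := fun p : R * R => snd p - fst p).
  set (inc := fun p : R * R => norm (vsub (x (snd p)) (x (fst p)))).
  set (Q := fun r s => exists l, nonoverlap l /\
    (forall p, In p l -> r <= fst p /\ fst p <= snd p /\ snd p <= s) /\
    (forall p, In p l -> exists k, ca k <= fst p /\ snd p <= cb k) /\
    g s - g r <= e * (s - r) + C * (sum_list len l + sum_list inc l)).
  assert (HQ : Q a b).
  { apply cousin; auto.
    - intros r s t Hrs Hst [l1 [Hn1 [Hi1 [Hk1 Hg1]]]] [l2 [Hn2 [Hi2 [Hk2 Hg2]]]].
      exists (l1 ++ l2); repeat split.
      + apply nonoverlap_app with s; auto; intros p Hp.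
        * now apply Hi1. * now apply Hi2.
      + apply in_app_or in H; destruct H as [H|H]; [apply Hi1 in H|apply Hi2 in H]; lra.
      + apply in_app_or in H; destruct H as [H|H]; [apply Hi1 in H|apply Hi2 in H]; lra.
      + apply in_app_or in H; destruct H as [H|H]; [apply Hi1 in H|apply Hi2 in H]; lra.
      + intros p Hp; apply in_app_or in Hp; destruct Hp; auto.
      + rewrite !sum_list_app. lra.
    - intros t Ht. destruct (classic (N t)) as [HNt|HNt].
      + destruct (Hlip t Ht) as [d [Hd Hl]].
        destruct (Hcov t HNt) as [k Hk].
        exists (Rmin d (Rmin (t - ca k) (cb k - t))); split.
        { repeat apply Rmin_glb_lt; lra. }
        intros r s Har Hrt Hts Hsb Hsr.
        assert (s - r < d /\ s - r < t - ca k /\ s - r < cb k - t) as [H1 [H2 H3]].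
        { generalize (Rmin_l d (Rmin (t - ca k) (cb k - t)))
            (Rmin_r d (Rmin (t - ca k) (cb k - t)))
            (Rmin_l (t - ca k) (cb k - t)) (Rmin_r (t - ca k) (cb k - t)); lra. }
        exists ((r, t) :: (t, s) :: nil); simpl; repeat split; auto.
        * intros q [<-|[]]; simpl; lra.
        * intros q [].
        * destruct H as [<-|[<-|[]]]; simpl; lra.
        * destruct H as [<-|[<-|[]]]; simpl; lra.
        * destruct H as [<-|[<-|[]]]; simpl; lra.
        * intros p [<-|[<-|[]]]; exists k; simpl; lra.
        * assert (Hr := Hl r). assert (Hs := Hl s).
          rewrite norm_vsub_sym in Hr.
          rewrite (Rabs_left1 (r - t)) in Hr by lra.
          rewrite (Rabs_right (s - t)) in Hs by lra.
          assert (Hr' := Hr ltac:(lra) ltac:(lra)).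
          assert (Hs' := Hs ltac:(lra) ltac:(lra)).
          unfold len, inc; simpl.
          assert (g t - g r <= C * (- (r - t) + norm (vsub (x t) (x r)))).
          { rewrite <- Rabs_Ropp in Hr'. eapply Rle_trans; [|exact Hr'].
            eapply Rle_trans; [|apply Rle_abs]; lra. }
          assert (g s - g t <= C * (s - t + norm (vsub (x s) (x t)))).
          { eapply Rle_trans; [|exact Hs']. apply Rle_abs. }
          assert (0 <= e * (s - r)) by (apply Rmult_le_pos; lra).
          lra.
      + destruct (Hder t Ht HNt e He) as [d [Hd Hl]].
        exists d; split; auto. intros r s Har Hrt Hts Hsb Hsr.
        exists nil; simpl; repeat split; auto; try (now intros p []); try (now destruct H).
        destruct (Hl r) as [_ Hr]; [lra|rewrite Rabs_left1; lra|].
        destruct (Hl s) as [Hs _]; [lra|rewrite Rabs_right; lra|].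
        specialize (Hr Hrt); specialize (Hs Hts). lra. }
  destruct HQ as [l [Hn [Hi [Hk Hg]]]].
  assert (Hlen : sum_list len l <= d1).
  { apply (total_length_le_cover ca cb l a d1); auto. intros p Hp; apply Hi in Hp; lra. }
  assert (Hinc : sum_list inc l < e).
  { apply Hac'; auto. change (sum_list len l < d0). lra. }
  assert (C * (sum_list len l + sum_list inc l) <= C * (2 * e)).
  { apply Rmult_le_compat_l; lra. }
  lra. }
apply Rnot_lt_le; intros Hlt.
(* The coefficient of [e] in [Hkey], plus one to make it positive; the [e] chosen next bounds the
   supposed increase by half of itself. *)
set (D := (b - a) + 2 * C + 1).
assert (HD : 0 < D) by (unfold D; lra).
assert (H := Hkey ((g b - g a) / (2 * D)) ltac:(apply Rdiv_lt_0_compat; lra)).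
assert (Heq : (g b - g a) / (2 * D) * D = (g b - g a) / 2) by (field; lra).
assert (0 < (g b - g a) / (2 * D)) by (apply Rdiv_lt_0_compat; lra).
unfold D in *; nra.
Qed.

(** * Vectors and null sets *)

Lemma finsum_plus n (a b : Fin.t n -> R) :
  finsum n (fun i => a i + b i) = finsum n a + finsum n b.
Proof. induction n as [|n IH]; simpl; [ring|rewrite IH; ring]. Qed.

Lemma finsum_scal n c (a : Fin.t n -> R) : finsum n (fun i => c * a i) = c * finsum n a.
Proof. induction n as [|n IH]; simpl; [ring|rewrite IH; ring]. Qed.

Lemma finsum_le n (a b : Fin.t n -> R) : (forall i, a i <= b i) -> finsum n a <= finsum n b.
Proof.
induction n as [|n IH]; simpl; intros H; [lra|]. apply Rplus_le_compat; auto.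
Qed.

Lemma finsum_nonneg n (a : Fin.t n -> R) : (forall i, 0 <= a i) -> 0 <= finsum n a.
Proof. induction n as [|n IH]; simpl; intros H; [lra|]. apply Rplus_le_le_0_compat; auto. Qed.

Lemma finsum_ge_term n (a : Fin.t n -> R) : (forall i, 0 <= a i) -> forall i, a i <= finsum n a.
Proof.
induction n as [|n IH]; intros H i; [inversion i|].
apply (Fin.caseS' i); simpl.
- generalize (finsum_nonneg n (fun j => a (Fin.FS j)) (fun j => H _)); lra.
- intros j. generalize (H Fin.F1) (IH (fun j => a (Fin.FS j)) (fun j => H _) j); simpl; lra.
Qed.

Lemma finsum_const n c : finsum n (fun _ => c) = INR n * c.
Proof. induction n as [|n IH]; simpl finsum; [simpl; ring|rewrite IH, S_INR; ring]. Qed.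

Lemma dot_self_nonneg n (x : vec n) : 0 <= dot x x.
Proof. apply finsum_nonneg; intros i; nra. Qed.

Lemma norm_nonneg n (x : vec n) : 0 <= norm x.
Proof. apply sqrt_pos. Qed.

Lemma norm_sqr n (x : vec n) : norm x * norm x = dot x x.
Proof. apply sqrt_sqrt, dot_self_nonneg. Qed.

Lemma norm_vsub_self n (x : vec n) : norm (vsub x x) = 0.
Proof.
unfold norm, dot, vsub. rewrite (finsum_ext _ _ (fun _ => 0)) by (intros; ring).
rewrite finsum_const, Rmult_0_r. apply sqrt_0.
Qed.

Lemma coord_le_norm n (x : vec n) i : Rabs (x i) <= norm x.
Proof.
rewrite <- sqrt_Rsqr_abs. apply sqrt_le_1_alt.
apply (finsum_ge_term n (fun i => x i * x i)); intros; nra.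
Qed.

Lemma norm_le_sum n (x : vec n) : norm x <= finsum n (fun i => Rabs (x i)).
Proof.
assert (0 <= finsum n (fun i => Rabs (x i))) by (apply finsum_nonneg; intros; apply Rabs_pos).
apply Rsqr_incr_0_var; auto. unfold Rsqr. rewrite norm_sqr.
unfold dot. clear H. induction n as [|n IH]; simpl; [lra|].
specialize (IH (fun i => x (Fin.FS i))). cbv beta in IH.
assert (0 <= finsum n (fun i => Rabs (x (Fin.FS i)))) by (apply finsum_nonneg; intros; apply Rabs_pos).
assert (x Fin.F1 * x Fin.F1 = Rabs (x Fin.F1) * Rabs (x Fin.F1))
  by (rewrite <- Rabs_mult, Rabs_right; nra).
generalize (Rabs_pos (x Fin.F1)); nra.
Qed.

Lemma norm_le_coords n (x : vec n) c : (forall i, Rabs (x i) <= c) -> norm x <= INR n * c.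
Proof.
intros H. rewrite <- finsum_const. eapply Rle_trans; [apply norm_le_sum|]. now apply finsum_le.
Qed.

Lemma dot_abs_le n (x y : vec n) : Rabs (dot x y) <= norm x * norm y.
Proof.
assert (Hq : forall c, 0 <= dot x x - 2 * c * dot x y + c * c * dot y y).
{ intros c. replace (dot x x - 2 * c * dot x y + c * c * dot y y)
    with (finsum n (fun i => (x i - c * y i) * (x i - c * y i))).
  - apply finsum_nonneg; intros; apply Rle_0_sqr.
  - unfold dot. replace (finsum n (fun i => x i * x i) - 2 * c * finsum n (fun i => x i * y i))
      with (finsum n (fun i => x i * x i) + (- (2 * c)) * finsum n (fun i => x i * y i)) by ring.
    rewrite <- !finsum_scal, <- !finsum_plus. apply finsum_ext; intros; ring. }
assert (H : dot x y * dot x y <= dot x x * dot y y).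
{ destruct (dot_self_nonneg n y) as [Hy|Hy].
  - specialize (Hq (dot x y / dot y y)).
    assert (E : dot x x - 2 * (dot x y / dot y y) * dot x y +
       dot x y / dot y y * (dot x y / dot y y) * dot y y
       = (dot x x * dot y y - dot x y * dot x y) / dot y y) by (field; lra).
    rewrite E in Hq. apply Rmult_le_compat_r with (r := dot y y) in Hq; [|lra].
    unfold Rdiv in Hq. rewrite Rmult_assoc, Rinv_l in Hq; lra.
  - rewrite <- Hy in *. destruct (Req_dec (dot x y) 0) as [->|Hne]; [lra|].
    (* With [dot y y = 0] the quadratic is affine in [c], and this [c] gives it the value [-1]. *)
    specialize (Hq ((dot x x + 1) / (2 * dot x y))).
    assert (E : 2 * ((dot x x + 1) / (2 * dot x y)) * dot x y = dot x x + 1) by (field; lra).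
    lra. }
rewrite <- !norm_sqr in H.
apply Rsqr_incr_0_var; [|apply Rmult_le_pos; apply norm_nonneg].
rewrite <- Rsqr_abs. unfold Rsqr. nra.
Qed.

Lemma norm_triangle n (x y z : vec n) : norm (vsub x z) <= norm (vsub x y) + norm (vsub y z).
Proof.
set (p := vsub x y). set (q := vsub y z).
apply Rsqr_incr_0_var; [|apply Rplus_le_le_0_compat; apply norm_nonneg].
unfold Rsqr. rewrite norm_sqr.
replace (dot (vsub x z) (vsub x z)) with (dot p p + 2 * dot p q + dot q q).
- rewrite <- !norm_sqr. generalize (dot_abs_le n p q) (Rle_abs (dot p q)); nra.
- unfold dot. rewrite <- finsum_scal, <- !finsum_plus. apply finsum_ext; intros i.
  unfold p, q, vsub; ring.
Qed.

Lemma norm_vsub_zero n (x : vec n) : norm (vsub x vzero) = norm x.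
Proof. unfold norm, dot, vsub, vzero. f_equal. apply finsum_ext; intros; ring. Qed.

Lemma norm_diff_le n (x y : vec n) : Rabs (norm x - norm y) <= norm (vsub x y).
Proof.
assert (H1 := norm_triangle n x y vzero). assert (H2 := norm_triangle n y x vzero).
rewrite !norm_vsub_zero in *. rewrite (norm_vsub_sym n y x) in H2. apply Rabs_le; lra.
Qed.

Lemma fin_common_delta n (P : Fin.t n -> R -> Prop) :
  (forall i d d', 0 < d' <= d -> P i d -> P i d') ->
  (forall i, exists d, 0 < d /\ P i d) -> exists d, 0 < d /\ forall i, P i d.
Proof.
induction n as [|n IH]; intros Hm H.
- exists 1; split; [lra|]. intros i; inversion i.
- destruct (IH (fun i => P (Fin.FS i)) (fun i => Hm _) (fun i => H _)) as [d [Hd H1]].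
  destruct (H Fin.F1) as [d' [Hd' H2]].
  exists (Rmin d d'). assert (0 < Rmin d d') by (apply Rmin_glb_lt; lra).
  split; auto. intros i. apply (Fin.caseS' i).
  + apply Hm with d'; auto. split; auto. apply Rmin_r.
  + intros j. apply Hm with d; auto. split; auto. apply Rmin_l.
Qed.

Lemma fin_common_bound n (P : Fin.t n -> R -> Prop) :
  (forall i c c', c <= c' -> P i c -> P i c') ->
  (forall i, exists c, P i c) -> exists c, forall i, P i c.
Proof.
induction n as [|n IH]; intros Hm H.
- exists 0; intros i; inversion i.
- destruct (IH (fun i => P (Fin.FS i)) (fun i => Hm _) (fun i => H _)) as [c H1].
  destruct (H Fin.F1) as [c' H2].
  exists (Rmax c c'). intros i. apply (Fin.caseS' i).
  + apply Hm with c'; auto. apply Rmax_r.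
  + intros j. apply Hm with c; auto. apply Rmax_l.
Qed.

Lemma outer_le_weaken (E E' : R -> Prop) e e' :
  (forall t, E' t -> E t) -> e <= e' -> outer_le E e -> outer_le E' e'.
Proof.
intros HE He [a [b [H1 [H2 H3]]]]. exists a, b; repeat split; auto.
intros K; eapply Rle_trans; [apply H3|auto].
Qed.

Lemma null_set_incl (E E' : R -> Prop) : (forall t, E' t -> E t) -> null_set E -> null_set E'.
Proof. intros H HE e He. apply outer_le_weaken with E e; auto; lra. Qed.

Lemma sum_interleave (p q : nat -> R) K :
  sum_f_R0 (fun k => if Nat.even k then p (Nat.div2 k) else q (Nat.div2 k)) (2 * K + 1)
  = sum_f_R0 p K + sum_f_R0 q K.
Proof.
induction K as [|K IH].
- simpl. ring.
- replace (2 * S K + 1)%nat with (S (S (2 * K + 1))) by lia.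
  rewrite !tech5, IH.
  replace (Nat.even (S (2 * K + 1))) with true.
  2:{ replace (S (2 * K + 1)) with (2 * (S K))%nat by lia. now rewrite Nat.even_mul. }
  replace (Nat.even (S (S (2 * K + 1)))) with false.
  2:{ replace (S (S (2 * K + 1))) with (1 + 2 * (S K))%nat by lia.
      rewrite Nat.even_add, Nat.even_mul. reflexivity. }
  replace (Nat.div2 (S (2 * K + 1))) with (S K).
  2:{ replace (S (2 * K + 1)) with (2 * S K)%nat by lia. now rewrite Nat.div2_double. }
  replace (Nat.div2 (S (S (2 * K + 1)))) with (S K).
  2:{ replace (S (S (2 * K + 1))) with (S (2 * S K))%nat by lia.
      now rewrite Nat.div2_succ_double. }
  ring.
Qed.

Lemma sum_f_R0_mono (w : nat -> R) K K' :
  (forall k, 0 <= w k) -> (K <= K')%nat -> sum_f_R0 w K <= sum_f_R0 w K'.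
Proof.
intros Hw HK. induction HK as [|K' HK IH]; [lra|]. simpl. generalize (Hw (S K')); lra.
Qed.

Lemma null_set_union (E E' : R -> Prop) :
  null_set E -> null_set E' -> null_set (fun t => E t \/ E' t).
Proof.
intros HE HE' e He.
destruct (HE (e / 2) ltac:(lra)) as [a [b [H1 [H2 H3]]]].
destruct (HE' (e / 2) ltac:(lra)) as [a' [b' [H1' [H2' H3']]]].
exists (fun k => if Nat.even k then a (Nat.div2 k) else a' (Nat.div2 k)),
       (fun k => if Nat.even k then b (Nat.div2 k) else b' (Nat.div2 k)).
repeat split.
- intros k; destruct (Nat.even k); auto.
- intros t [Ht|Ht].
  + destruct (H2 t Ht) as [k Hk]. exists (2 * k)%nat.
    rewrite Nat.even_mul, Nat.div2_double. exact Hk.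
  + destruct (H2' t Ht) as [k Hk]. exists (S (2 * k)).
    rewrite Nat.even_succ, Nat.odd_mul, Nat.div2_succ_double. exact Hk.
- intros K.
  (* The partial sum is prolonged to the index [2 * K + 1], where it splits into equally long
     partial sums of the two covers. *)
  apply Rle_trans with (sum_f_R0 (fun k => if Nat.even k
     then (fun j => b j - a j) (Nat.div2 k) else (fun j => b' j - a' j) (Nat.div2 k)) (2 * K + 1)).
  + eapply Rle_trans; [|apply sum_f_R0_mono with (K := K); [|lia]].
    * right. apply sum_eq; intros k _. destruct (Nat.even k); reflexivity.
    * intros k. destruct (Nat.even k); [generalize (H1 (Nat.div2 k))|generalize (H1' (Nat.div2 k))]; lra.
  + assert (E'' := sum_interleave (fun j => b j - a j) (fun j => b' j - a' j) K).
    cbv beta in *. rewrite E''. generalize (H3 K) (H3' K); lra.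
Qed.

Lemma null_set_point p : null_set (fun t => t = p).
Proof.
intros e He.
exists (fun k => match k with O => p - e / 2 | _ => 0 end),
       (fun k => match k with O => p + e / 2 | _ => 0 end).
repeat split.
- intros [|k]; lra.
- intros t ->; exists 0%nat; lra.
- intros K. induction K as [|K IH]; simpl; lra.
Qed.

Lemma null_set_empty : null_set (fun _ => False).
Proof. apply null_set_incl with (fun t => t = 0); [now intros|apply null_set_point]. Qed.

Lemma null_set_list (l : list R) : null_set (fun t => In t l).
Proof.
induction l as [|p l IH]; simpl; [apply null_set_empty|].
apply null_set_union; auto.
apply null_set_incl with (fun t => t = p); [now intros|apply null_set_point].
Qed.

Lemma null_set_fin n (E : Fin.t n -> R -> Prop) :
  (forall i, null_set (E i)) -> null_set (fun t => exists i, E i t).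
Proof.
induction n as [|n IH]; intros H.
- apply null_set_incl with (fun _ => False); [|apply null_set_empty].
  intros t [i _]; inversion i.
- apply null_set_incl with (fun t => E Fin.F1 t \/ exists i, E (Fin.FS i) t).
  + intros t [i Hi]. revert Hi. apply (Fin.caseS' i); [now left|]. intros j Hj; right; now exists j.
  + apply null_set_union; auto.
Qed.

(** The end points join the null set, so that a two-sided derivative is asked for in the open
    interval only; at the initial time [V] may have just a one-sided one. *)
Lemma ae_monotone_deriv {n : nat} (x : R -> vec n) (g : R -> R) (N : R -> Prop) (a b C : R) :
  a <= b -> 0 <= C -> abs_continuous x a b -> null_set N ->
  (forall t, a <= t <= b -> exists d, 0 < d /\ forall s, a <= s <= b -> Rabs (s - t) < d ->
     Rabs (g s - g t) <= C * (Rabs (s - t) + norm (vsub (x s) (x t)))) ->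
  (forall t, a < t < b -> ~ N t -> exists L, L <= 0 /\ derivable_pt_lim g t L) ->
  g b <= g a.
Proof.
intros Hab HC Hac HN Hlip Hder.
apply (ae_monotone x g (fun t => N t \/ (t = a \/ t = b)) a b C); auto.
- repeat apply null_set_union; auto using null_set_point.
- intros t Ht HNt e He.
  destruct (Hder t) as [L [HL Hd]].
  { assert (t <> a) by tauto. assert (t <> b) by tauto. lra. }
  { tauto. }
  destruct (Hd e He) as [d Hd'].
  exists d; split; [apply cond_pos|]. intros s Hs Hst.
  destruct (Req_dec s t) as [->|Hne]; [split; intros; lra|].
  specialize (Hd' (s - t) ltac:(lra) Hst). replace (t + (s - t)) with s in Hd' by ring.
  apply Rabs_def2 in Hd'.
  assert (E : (g s - g t) / (s - t) * (s - t) = g s - g t) by (field; lra).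
  split; intros H.
  + assert ((g s - g t) / (s - t) * (s - t) <= e * (s - t)) by (apply Rmult_le_compat_r; lra). lra.
  + assert (- ((g s - g t) / (s - t) * (s - t)) <= e * (t - s)); [|lra].
    replace (- ((g s - g t) / (s - t) * (s - t))) with ((g s - g t) / (s - t) * (t - s)) by ring.
    apply Rmult_le_compat_r; lra.
Qed.

(** * Integrals of piecewise continuous functions *)

Definition rlim (g : R -> R) (t b : R) : Prop :=
  exists L, forall e, 0 < e -> exists d, 0 < d /\
    forall s, t < s <= b -> s - t < d -> Rabs (g s - L) < e.
Definition llim (g : R -> R) (a t : R) : Prop :=
  exists L, forall e, 0 < e -> exists d, 0 < d /\
    forall s, a <= s < t -> t - s < d -> Rabs (g s - L) < e.

(** Redefining [g] at the end points by its one-sided limits, and extending it by these constants,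
    gives a function [h] continuous on the closed interval; the integral does not see the change. *)
Lemma ex_RInt_inner_continuous (g : R -> R) a b : a < b ->
  (forall t, a < t < b -> forall e, 0 < e -> exists d, 0 < d /\
     forall s, a <= s <= b -> Rabs (s - t) < d -> Rabs (g s - g t) < e) ->
  rlim g a b -> llim g a b -> ex_RInt g a b.
Proof.
intros Hab Hc [La HLa] [Lb HLb].
set (h := fun t => if Rle_dec t a then La else if Rle_dec b t then Lb else g t).
assert (Hh : forall t, a < t < b -> h t = g t).
{ intros t Ht; unfold h. destruct Rle_dec; [lra|]. destruct Rle_dec; [lra|auto]. }
apply ex_RInt_ext with h.
{ intros t. rewrite Rmin_left, Rmax_right by lra. apply Hh. }
apply (ex_RInt_continuous (V := R_CompleteNormedModule)).
rewrite Rmin_left, Rmax_right by lra. intros t Ht.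
apply continuity_pt_filterlim.
intros e He.
assert (Hgoal : exists d, 0 < d /\ forall s, s <> t -> Rabs (s - t) < d -> Rabs (h s - h t) < e).
{ destruct (Req_dec t a) as [->|Hta]; [|destruct (Req_dec t b) as [->|Htb]].
  - destruct (HLa e He) as [d [Hd H]]. exists (Rmin d (b - a)); split; [apply Rmin_glb_lt; lra|].
    intros s Hs Hsa.
    assert (Rabs (s - a) < d /\ Rabs (s - a) < b - a) as [H1 H2]
      by (generalize (Rmin_l d (b - a)) (Rmin_r d (b - a)); lra).
    apply Rabs_def2 in H1; apply Rabs_def2 in H2.
    replace (h a) with La by (unfold h; destruct Rle_dec; lra).
    destruct (Rle_lt_dec s a).
    + replace (h s) with La by (unfold h; destruct Rle_dec; lra).
      rewrite Rminus_diag_eq, Rabs_R0; auto.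
    + rewrite Hh by lra. apply H; lra.
  - destruct (HLb e He) as [d [Hd H]]. exists (Rmin d (b - a)); split; [apply Rmin_glb_lt; lra|].
    intros s Hs Hsa.
    assert (Rabs (s - b) < d /\ Rabs (s - b) < b - a) as [H1 H2]
      by (generalize (Rmin_l d (b - a)) (Rmin_r d (b - a)); lra).
    apply Rabs_def2 in H1; apply Rabs_def2 in H2.
    replace (h b) with Lb by (unfold h; destruct Rle_dec; [lra|destruct Rle_dec; lra]).
    destruct (Rle_lt_dec b s).
    + replace (h s) with Lb by (unfold h; destruct Rle_dec; [lra|destruct Rle_dec; lra]).
      rewrite Rminus_diag_eq, Rabs_R0; auto.
    + rewrite Hh by lra. apply H; lra.
  - destruct (Hc t ltac:(lra) e He) as [d [Hd H]].
    exists (Rmin d (Rmin (t - a) (b - t))); split; [repeat apply Rmin_glb_lt; lra|].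
    intros s Hs Hst.
    assert (Rabs (s - t) < d /\ Rabs (s - t) < t - a /\ Rabs (s - t) < b - t) as [H1 [H2 H3]]
      by (generalize (Rmin_l d (Rmin (t - a) (b - t))) (Rmin_r d (Rmin (t - a) (b - t)))
           (Rmin_l (t - a) (b - t)) (Rmin_r (t - a) (b - t)); lra).
    assert (H2' := Rabs_def2 _ _ H2). assert (H3' := Rabs_def2 _ _ H3).
    rewrite !Hh by lra. apply H; [lra|auto]. }
destruct Hgoal as [d [Hd H]]. exists d; split; [lra|].
intros s [[_ Hs] Hst]. apply H; auto.
Qed.

(** Induction on the exceptional points, an interior one splitting the interval. One-sided limits
    are assumed at every point, so that the hypotheses survive the restriction to a subinterval
    ending at [p]. *)
Lemma ex_RInt_piecewise (g : R -> R) (l : list R) : forall a b, a <= b ->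
  (forall t, a < t < b -> ~ In t l -> forall e, 0 < e -> exists d, 0 < d /\
     forall s, a <= s <= b -> Rabs (s - t) < d -> Rabs (g s - g t) < e) ->
  (forall t, a <= t < b -> rlim g t b) -> (forall t, a < t <= b -> llim g a t) ->
  ex_RInt g a b.
Proof.
induction l as [|p l IH]; intros a b Hab Hc Hr Hl.
- destruct Hab as [Hab|<-]; [|apply ex_RInt_point].
  apply ex_RInt_inner_continuous; auto; [apply Hr; lra|apply Hl; lra].
- destruct (classic (a < p < b)) as [Hp|Hp].
  + assert (Hcase : forall a' b', a <= a' -> a' <= b' -> b' <= b -> (b' <= p \/ p <= a') ->
      ex_RInt g a' b').
    { intros a' b' H1 H2 H3 H4. apply IH; auto.
      - intros t Ht Hin e He. destruct (Hc t ltac:(lra)) with (e := e) as [d [Hd H]]; auto.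
        { intros [->|Hin']; [lra|auto]. }
        exists d; split; auto. intros s Hs. apply H; lra.
      - intros t Ht. destruct (Hr t ltac:(lra)) as [L HL]. exists L; intros e He.
        destruct (HL e He) as [d [Hd H]]; exists d; split; auto. intros s Hs; apply H; lra.
      - intros t Ht. destruct (Hl t ltac:(lra)) as [L HL]. exists L; intros e He.
        destruct (HL e He) as [d [Hd H]]; exists d; split; auto. intros s Hs; apply H; lra. }
    apply ex_RInt_Chasles with p; apply Hcase; lra.
  + apply IH; auto. intros t Ht Hin. apply Hc; auto. intros [->|Hin']; [lra|auto].
Qed.

(** Collects what the integrating factor requires: a Lipschitz primitive of [mu], its derivative off
    finitely many points, and the stability bound rewritten for its increments. The stability
    hypothesis speaks of integrals with a proof of integrability, and piecewise continuity provides
    that proof on each subinterval. *)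
Lemma UES_primitive (tsharp : R) (mu : R -> R) (alpha beta a b : R) :
  piecewise_continuous tsharp mu ->
  (forall t0 t (pr : Riemann_integrable mu t0 t),
      inJ tsharp t0 -> t0 <= t -> RiemannInt pr <= - alpha * (t - t0) + beta) ->
  tsharp <= a -> a <= b ->
  exists (Mu : R -> R) (B : R) (N : R -> Prop), 0 <= B /\ null_set N /\
    (forall s t, a <= s <= b -> a <= t <= b -> Rabs (Mu s - Mu t) <= B * Rabs (s - t)) /\
    (forall t, a < t < b -> ~ N t -> derivable_pt_lim Mu t (mu t)) /\
    (forall s t, a <= s -> s <= t -> t <= b -> Mu t - Mu s <= - alpha * (t - s) + beta).
Proof.
intros Hpc Hues Ha Hab.
destruct (Hpc a b Ha Hab) as [l [Hc Hl]].
assert (Hint : ex_RInt mu a b).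
{ apply ex_RInt_piecewise with l; auto.
  - intros t Ht. apply Hc; lra.
  - intros t Ht. destruct (classic (In t l)) as [Hin|Hin].
    + destruct (Hl t Hin) as [_ H]. apply H; lra.
    + exists (mu t). intros e He. destruct (Hc t ltac:(lra) Hin e He) as [d [Hd H]].
      exists d; split; auto. intros s Hs Hst. apply H; [lra|]. rewrite Rabs_right; lra.
  - intros t Ht. destruct (classic (In t l)) as [Hin|Hin].
    + destruct (Hl t Hin) as [H _]. apply H; lra.
    + exists (mu t). intros e He. destruct (Hc t ltac:(lra) Hin e He) as [d [Hd H]].
      exists d; split; auto. intros s Hs Hst. apply H; [lra|]. rewrite Rabs_left; lra. }
assert (Hsub : forall s t, a <= s -> s <= t -> t <= b -> ex_RInt mu s t).
{ intros s t H1 H2 H3. apply (ex_RInt_Chasles_1 (V := R_CompleteNormedModule)) with b; [lra|].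
  apply (ex_RInt_Chasles_2 (V := R_CompleteNormedModule)) with a; auto; lra. }
assert (Hinc : forall s t, a <= s -> s <= t -> t <= b -> RInt mu a t - RInt mu a s = RInt mu s t).
{ intros s t H1 H2 H3.
  rewrite <- (RInt_Chasles (V := R_CompleteNormedModule) mu a s t); try (apply Hsub; lra).
  unfold plus; simpl; ring. }
destruct (ex_RInt_ub (V := R_NormedModule) mu a b Hint) as [B HB].
rewrite Rmin_left, Rmax_right in HB by lra. change (forall t, a <= t <= b -> Rabs (mu t) <= B) in HB.
assert (HB0 : 0 <= B) by (eapply Rle_trans; [apply Rabs_pos|apply (HB a); lra]).
assert (Hlip : forall s t, a <= s -> s <= t -> t <= b ->
  Rabs (RInt mu a t - RInt mu a s) <= B * (t - s)).
{ intros s t H1 H2 H3. rewrite Hinc by auto. rewrite Rmult_comm.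
  apply abs_RInt_le_const; auto. intros r Hr; apply HB; lra. }
exists (fun t => RInt mu a t), B, (fun t => In t l); repeat split; auto.
- apply null_set_list.
- intros s t Hs Ht. destruct (Rle_lt_dec s t).
  + rewrite Rabs_minus_sym, (Rabs_left1 (s - t)) by lra.
    replace (- (s - t)) with (t - s) by ring. apply Hlip; lra.
  + rewrite (Rabs_right (s - t)) by lra. apply Hlip; lra.
- intros t Ht Hin e He.
  destruct (Hc t ltac:(lra) Hin (e / 2) ltac:(lra)) as [d [Hd H]].
  assert (Hd' : 0 < Rmin d (Rmin (t - a) (b - t))) by (repeat apply Rmin_glb_lt; lra).
  exists (mkposreal _ Hd'). simpl. intros h Hh Hhd.
  assert (Rabs h < d /\ Rabs h < t - a /\ Rabs h < b - t) as [H1 [H2 H3]]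
    by (generalize (Rmin_l d (Rmin (t - a) (b - t))) (Rmin_r d (Rmin (t - a) (b - t)))
         (Rmin_l (t - a) (b - t)) (Rmin_r (t - a) (b - t)); lra).
  apply Rabs_def2 in H2; apply Rabs_def2 in H3.
  (* Both signs of [h] reduce to an ordered interval with [t] as one end; [e / 2] makes up for the
     integral bound not being strict. *)
  assert (Hkey : forall r s, a <= r -> r <= t -> t <= s -> s <= b -> (r = t \/ s = t) -> s - r = Rabs h ->
     Rabs (RInt mu r s - mu t * (s - r)) <= (s - r) * (e / 2)).
  { intros r s Hr Hrt Hts Hs _ Hrs.
    replace (mu t * (s - r)) with (RInt (fun _ => mu t) r s)
      by (rewrite RInt_const; unfold scal; simpl; unfold mult; simpl; ring).
    assert (E : RInt mu r s - RInt (fun _ => mu t) r s = RInt (fun z => mu z - mu t) r s).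
    { symmetry. apply (RInt_minus (V := R_CompleteNormedModule)); [apply Hsub; lra|apply ex_RInt_const]. }
    rewrite E. apply abs_RInt_le_const; [lra| |].
    - apply (ex_RInt_minus (V := R_NormedModule)); [apply Hsub; lra|apply ex_RInt_const].
    - intros z Hz. left. apply H; [lra|]. apply Rabs_def1; lra. }
  assert (Habs : 0 < Rabs h) by now apply Rabs_pos_lt.
  assert (Hfin : Rabs (RInt mu a (t + h) - RInt mu a t - mu t * h) <= Rabs h * (e / 2)).
  { destruct (Rle_lt_dec 0 h).
    - rewrite Hinc by lra. rewrite (Rabs_right h) by lra.
      assert (K := Hkey t (t + h)). replace (t + h - t) with h in K by ring.
      apply K; try lra. rewrite Rabs_right; lra.
    - replace (RInt mu a (t + h) - RInt mu a t - mu t * h)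
        with (- ((RInt mu a t - RInt mu a (t + h)) - mu t * (t - (t + h)))) by ring.
      rewrite Rabs_Ropp, Hinc by lra.
      replace (Rabs h) with (t - (t + h)) by (rewrite Rabs_left; lra).
      apply Hkey; try lra. rewrite Rabs_left; lra. }
  replace ((RInt mu a (t + h) - RInt mu a t) / h - mu t)
    with ((RInt mu a (t + h) - RInt mu a t - mu t * h) / h) by (field; auto).
  unfold Rdiv. rewrite Rabs_mult, Rabs_inv.
  apply Rmult_lt_reg_r with (Rabs h); auto.
  rewrite Rmult_assoc, Rinv_l by lra. nra.
- intros s t Hs Hst Ht. rewrite Hinc by auto.
  assert (pr := ex_RInt_Reals_0 _ _ _ (Hsub s t Hs Hst Ht)).
  rewrite (RInt_Reals mu s t pr). apply Hues; unfold inJ; lra.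
Qed.

(** * The Lyapunov estimate *)

Lemma abs_continuous_sub {n} (x : R -> vec n) a b a' b' :
  a <= a' -> b' <= b -> abs_continuous x a b -> abs_continuous x a' b'.
Proof.
intros Ha Hb Hx e He. destruct (Hx e He) as [d [Hd H]]. exists d; split; auto.
intros l Hl. apply H. intros p Hp. specialize (Hl p Hp). lra.
Qed.

Definition cont_on {n} (x : R -> vec n) (a b : R) : Prop :=
  forall t, a <= t <= b -> forall e, 0 < e -> exists d, 0 < d /\
    forall s, a <= s <= b -> Rabs (s - t) < d -> norm (vsub (x s) (x t)) < e.

Lemma abs_continuous_cont_on {n} (x : R -> vec n) a b : abs_continuous x a b -> cont_on x a b.
Proof.
intros Hx t Ht e He. destruct (Hx e He) as [d [Hd H]]. exists d; split; auto.
intros s Hs Hst.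
assert (Hone : forall r q, a <= r -> r <= q -> q <= b -> q - r < d -> norm (vsub (x q) (x r)) < e).
{ intros r q H1 H2 H3 H4. specialize (H ((r, q) :: nil)). simpl in H.
  rewrite !Rplus_0_r in H. apply H; auto.
  - intros p [<-|[]]; simpl; lra.
  - split; auto. intros p []. }
apply Rabs_def2 in Hst. destruct (Rle_lt_dec t s).
- apply Hone; lra.
- rewrite norm_vsub_sym. apply Hone; lra.
Qed.

Lemma vadd_vsub n (x y : vec n) : vadd x (vsub y x) = y.
Proof. apply functional_extensionality; intros i; unfold vadd, vsub; ring. Qed.

Lemma derivable_vector {n} (x : R -> vec n) (t : R) (v : vec n) :
  (forall i, derivable_pt_lim (fun s => x s i) t (v i)) ->
  forall e, 0 < e -> exists d, 0 < d /\ forall h, Rabs h < d ->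
    norm (fun i => x (t + h) i - x t i - h * v i) <= e * Rabs h.
Proof.
intros Hx e He.
assert (Hn : 0 < INR n + 1) by (generalize (pos_INR n); lra).
destruct (fin_common_delta n (fun i d => forall h, Rabs h < d ->
   Rabs (x (t + h) i - x t i - h * v i) <= e / (INR n + 1) * Rabs h)) as [d [Hd H]].
- intros i d d' Hd H h Hh. apply H; lra.
- intros i. destruct (Hx i (e / (INR n + 1))) as [d Hd]; [now apply Rdiv_lt_0_compat|].
  exists d; split; [apply cond_pos|]. intros h Hh.
  destruct (Req_dec h 0) as [->|Hh0].
  + rewrite Rplus_0_r. replace (x t i - x t i - 0 * v i) with 0 by ring. rewrite Rabs_R0; lra.
  + specialize (Hd h Hh0 Hh).
    replace (x (t + h) i - x t i - h * v i) with (((x (t + h) i - x t i) / h - v i) * h)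
      by (field; auto).
    rewrite Rabs_mult. apply Rmult_le_compat_r; [apply Rabs_pos|lra].
- exists d; split; auto. intros h Hh.
  eapply Rle_trans; [apply norm_le_coords; intros i; apply H; auto|].
  rewrite <- Rmult_assoc. apply Rmult_le_compat_r; [apply Rabs_pos|].
  replace (INR n * (e / (INR n + 1))) with (e * (INR n / (INR n + 1))) by (field; lra).
  rewrite <- (Rmult_1_r e) at 2. apply Rmult_le_compat_l; [lra|].
  apply Rmult_le_reg_r with (INR n + 1); auto. unfold Rdiv. rewrite Rmult_assoc, Rinv_l; lra.
Qed.

Lemma norm_scal n c (v : vec n) : norm (fun i => c * v i) = Rabs c * norm v.
Proof.
unfold norm, dot. rewrite (finsum_ext _ _ (fun i => (c * c) * (v i * v i))) by (intros; ring).
rewrite finsum_scal, sqrt_mult_alt by nra. f_equal.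
change (c * c) with (Rsqr c). apply sqrt_Rsqr_abs.
Qed.

Lemma dot_add_r n (p x y : vec n) : dot p (fun i => x i + y i) = dot p x + dot p y.
Proof. unfold dot. rewrite <- finsum_plus. apply finsum_ext; intros; ring. Qed.

Lemma dot_scal_r n (p x : vec n) c : dot p (fun i => c * x i) = c * dot p x.
Proof. unfold dot. rewrite <- finsum_scal. apply finsum_ext; intros; ring. Qed.

Lemma derivable_along {n} (tsharp : R) (V Vt : R -> vec n -> R) (Vx : R -> vec n -> vec n)
  (HV : C1_with_partials tsharp V Vt Vx) (x : R -> vec n) (t : R) (v : vec n) :
  tsharp < t -> (forall i, derivable_pt_lim (fun s => x s i) t (v i)) ->
  derivable_pt_lim (fun s => V s (x s)) t (Vt t (x t) + dot (Vx t (x t)) v).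
Proof.
intros Ht Hx e He.
(* As [e2 <= 1], [c] bounds the difference quotients of [x] near [t]. The choice of [e1] and [e2]
   leaves [e / 2] for the remainder of [V] and [e / 4] for that of [x]. *)
set (c := norm v + 1). set (p := Vx t (x t)).
assert (Hc : 1 <= c) by (unfold c; generalize (norm_nonneg n v); lra).
assert (Hp : 0 <= norm p) by apply norm_nonneg.
set (e1 := e / (2 * (1 + c))).
assert (He1 : 0 < e1) by (unfold e1; apply Rdiv_lt_0_compat; lra).
set (e2 := Rmin 1 (e / (4 * (norm p + 1)))).
assert (He2 : 0 < e2) by (unfold e2; apply Rmin_glb_lt; [lra|apply Rdiv_lt_0_compat; lra]).
assert (He2' : e2 <= 1) by apply Rmin_l.
assert (He2'' : e2 <= e / (4 * (norm p + 1))) by apply Rmin_r.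
destruct (HV t (x t)) as [HVd _]; [unfold inJ; lra|]. destruct (HVd e1 He1) as [d1 [Hd1 H1]].
destruct (derivable_vector x t v Hx e2 He2) as [d2 [Hd2 H2]].
assert (Hd : 0 < Rmin (Rmin d2 (t - tsharp)) (d1 / c)).
{ repeat apply Rmin_glb_lt; try lra. apply Rdiv_lt_0_compat; lra. }
exists (mkposreal _ Hd); simpl. intros h Hh0 Hh.
assert (Rabs h < d2 /\ Rabs h < t - tsharp /\ Rabs h < d1 / c) as [Ha [Hb Hcc]].
{ generalize (Rmin_l (Rmin d2 (t - tsharp)) (d1 / c)) (Rmin_r (Rmin d2 (t - tsharp)) (d1 / c))
   (Rmin_l d2 (t - tsharp)) (Rmin_r d2 (t - tsharp)); lra. }
assert (Hpos : 0 < Rabs h) by now apply Rabs_pos_lt.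
specialize (H2 h Ha).
set (k := vsub (x (t + h)) (x t)).
set (r := fun i => x (t + h) i - x t i - h * v i) in *.
assert (Ek : k = fun i => h * v i + r i).
{ apply functional_extensionality; intros i; unfold k, r, vsub; ring. }
assert (Hk : norm k <= c * Rabs h).
{ assert (T := norm_triangle n k (fun i => h * v i) vzero).
  rewrite !norm_vsub_zero, norm_scal in T.
  replace (vsub k (fun i => h * v i)) with r in T.
  - unfold c. nra.
  - rewrite Ek. apply functional_extensionality; intros i; unfold vsub; ring. }
assert (Hcd : c * Rabs h < d1).
{ apply Rmult_lt_compat_l with (r := c) in Hcc; [|lra].
  replace (c * (d1 / c)) with d1 in Hcc by (field; lra). lra. }
assert (Hh1 : Rabs h < d1) by nra.
assert (HJ : inJ tsharp (t + h)).
{ unfold inJ. apply Rabs_def2 in Hb. lra. }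
specialize (H1 h k HJ Hh1 ltac:(lra)).
unfold k at 1 in H1. rewrite vadd_vsub in H1. rewrite Ek in H1 at 1.
rewrite dot_add_r, dot_scal_r in H1. fold p in H1.
assert (Hr := dot_abs_le n p r).
assert (Hmain : Rabs (V (t + h) (x (t + h)) - V t (x t) - (Vt t (x t) + dot p v) * h)
  <= e1 * (1 + c) * Rabs h + norm p * e2 * Rabs h).
{ replace (V (t + h) (x (t + h)) - V t (x t) - (Vt t (x t) + dot p v) * h)
  with ((V (t + h) (x (t + h)) - V t (x t) - Vt t (x t) * h - (h * dot p v + dot p r)) + dot p r)
  by ring.
  eapply Rle_trans; [apply Rabs_triang|]. apply Rplus_le_compat.
  - eapply Rle_trans; [exact H1|]. nra.
  - eapply Rle_trans; [exact Hr|]. rewrite Rmult_assoc. now apply Rmult_le_compat_l. }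
assert (E1 : e1 * (1 + c) = e / 2) by (unfold e1; field; lra).
assert (E2 : norm p * e2 <= e / 4).
{ apply Rle_trans with ((norm p + 1) * (e / (4 * (norm p + 1)))).
  - apply Rmult_le_compat; lra.
  - right; field; lra. }
replace ((V (t + h) (x (t + h)) - V t (x t)) / h - (Vt t (x t) + dot p v))
  with ((V (t + h) (x (t + h)) - V t (x t) - (Vt t (x t) + dot p v) * h) / h) by (field; auto).
unfold Rdiv. rewrite Rabs_mult, Rabs_inv. apply Rmult_lt_reg_r with (Rabs h); auto.
rewrite Rmult_assoc, Rinv_l by lra. rewrite E1 in Hmain. nra.
Qed.

(** The expansion of [V] at the tag with unit error costs slope [1] beyond its partial derivatives,
    and these are bounded along the trajectory by continuity and compactness. Only the radius [d]
    depends on the tag, which a Cousin partition permits. *)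
Lemma tag_lipschitz_along {n} (tsharp : R) (V Vt : R -> vec n -> R) (Vx : R -> vec n -> vec n)
  (HV : C1_with_partials tsharp V Vt Vx) (x : R -> vec n) (a b : R) :
  tsharp <= a -> a <= b -> cont_on x a b ->
  exists C, 0 <= C /\ forall t, a <= t <= b -> exists d, 0 < d /\
    forall s, a <= s <= b -> Rabs (s - t) < d ->
      Rabs (V s (x s) - V t (x t)) <= C * (Rabs (s - t) + norm (vsub (x s) (x t))).
Proof.
intros Ha Hab Hx.
assert (HB : exists C, forall t, a <= t <= b -> Rabs (Vt t (x t)) + norm (Vx t (x t)) <= C).
{ apply (cousin (fun r s => exists C, forall t, r <= t <= s ->
     Rabs (Vt t (x t)) + norm (Vx t (x t)) <= C) a b Hab).
  - intros r s t _ _ [C1 H1] [C2 H2]. exists (Rmax C1 C2). intros q Hq.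
    destruct (Rle_lt_dec q s).
    + eapply Rle_trans; [apply H1; lra|apply Rmax_l].
    + eapply Rle_trans; [apply H2; lra|apply Rmax_r].
  - intros t Ht. destruct (HV t (x t)) as [_ H]; [unfold inJ; lra|].
    destruct (H 1 ltac:(lra)) as [d [Hd H']].
    destruct (Hx t Ht d Hd) as [d' [Hd' H'']].
    exists (Rmin d d'); split; [apply Rmin_glb_lt; auto|]. intros r s Hr Hrt Hts Hs Hrs.
    exists (Rabs (Vt t (x t)) + norm (Vx t (x t)) + 2). intros q Hq.
    assert (Hqt : Rabs (q - t) < Rmin d d') by (apply Rabs_def1; lra).
    generalize (Rmin_l d d') (Rmin_r d d'); intros.
    destruct (H' q (x q)) as [K1 K2]; [unfold inJ; lra|lra|apply H''; lra|].
    assert (K3 := norm_diff_le n (Vx q (x q)) (Vx t (x t))).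
    assert (K4 := Rabs_triang_inv (Vt q (x q)) (Vt t (x t))).
    assert (K5 := Rle_abs (norm (Vx q (x q)) - norm (Vx t (x t)))). lra. }
destruct HB as [C HC]. exists (Rmax C 0 + 1); split; [generalize (Rmax_r C 0); lra|].
intros t Ht.
destruct (HV t (x t)) as [H _]; [unfold inJ; lra|]. destruct (H 1 ltac:(lra)) as [d [Hd H']].
destruct (Hx t Ht d Hd) as [d' [Hd' H'']].
exists (Rmin d d'); split; [apply Rmin_glb_lt; auto|]. intros s Hs Hst.
generalize (Rmin_l d d') (Rmin_r d d'); intros.
specialize (H' (s - t) (vsub (x s) (x t))).
replace (t + (s - t)) with s in H' by ring. rewrite vadd_vsub in H'.
specialize (H' ltac:(unfold inJ; lra) ltac:(lra) ltac:(apply H''; lra)).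
assert (D := dot_abs_le n (Vx t (x t)) (vsub (x s) (x t))).
specialize (HC t Ht). assert (Cle := Rmax_l C 0).
set (q := norm (vsub (x s) (x t))) in *. assert (Hq : 0 <= q) by apply norm_nonneg.
assert (Hs0 := Rabs_pos (s - t)).
assert (T1 : Rabs (Vt t (x t) * (s - t)) <= Rmax C 0 * Rabs (s - t)).
{ rewrite Rabs_mult. apply Rmult_le_compat_r; auto. generalize (norm_nonneg n (Vx t (x t))); lra. }
assert (T2 : norm (Vx t (x t)) * q <= Rmax C 0 * q).
{ apply Rmult_le_compat_r; auto. generalize (Rabs_pos (Vt t (x t))); lra. }
replace (V s (x s) - V t (x t)) with
  ((V s (x s) - V t (x t) - Vt t (x t) * (s - t) - dot (Vx t (x t)) (vsub (x s) (x t)))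
   + (Vt t (x t) * (s - t)) + dot (Vx t (x t)) (vsub (x s) (x t))) by ring.
eapply Rle_trans; [apply Rabs_triang|].
eapply Rle_trans; [apply Rplus_le_compat_r, Rabs_triang|]. lra.
Qed.

(** The supremum of the times with [W <= c] is one of them by continuity; if there are none, [a]
    takes its place, whence the disjunction. *)
Lemma last_time_below (W : R -> R) (a b c : R) : a <= b ->
  (forall t, a <= t <= b -> forall e, 0 < e -> exists d, 0 < d /\
    forall s, a <= s <= b -> Rabs (s - t) < d -> Rabs (W s - W t) < e) ->
  c < W b ->
  exists s, a <= s <= b /\ (s = a \/ W s <= c) /\ forall t, s < t <= b -> c < W t.
Proof.
intros Hab Hc Hb.
destruct (classic (exists t, a <= t <= b /\ W t <= c)) as [[t0 Ht0]|Hno].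
2:{ exists a; repeat split; [lra|lra|now left|].
    intros t Ht. apply Rnot_le_lt; intros H. apply Hno; exists t; split; [lra|auto]. }
destruct (completeness (fun t => a <= t <= b /\ W t <= c)) as [m [Hub Hlub]].
{ exists b; intros t [Ht _]; lra. }
{ now exists t0. }
assert (Hm : a <= m <= b).
{ split; [apply Rle_trans with t0; [lra|now apply Hub]|apply Hlub; intros t [Ht _]; lra]. }
exists m; split; [auto|split].
- right. apply Rnot_lt_le; intros Hlt.
  destruct (Hc m Hm (W m - c) ltac:(lra)) as [d [Hd H]].
  assert (m <= m - d); [|lra]. apply Hlub. intros t [Ht HWt].
  apply Rnot_lt_le; intros Hlt'. assert (t <= m) by (apply Hub; auto).
  specialize (H t Ht ltac:(apply Rabs_def1; lra)). apply Rabs_def2 in H. lra.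
- intros t Ht. apply Rnot_le_lt; intros H.
  assert (t <= m) by (apply Hub; split; [lra|auto]). lra.
Qed.

(** For [p <= q], the inequality [1 + y <= exp y] at [y = p - q], multiplied by [exp q], already
    bounds the increment. *)
Lemma exp_lipschitz D p q : p <= D -> q <= D -> Rabs (exp p - exp q) <= exp D * Rabs (p - q).
Proof.
assert (H : forall p q, p <= q -> q <= D -> exp q - exp p <= exp D * (q - p)).
{ intros p' q' H1 H2.
  assert (E := exp_ineq1_le (p' - q')). assert (Hq := exp_pos q').
  assert (exp p' = exp q' * exp (p' - q')) by (rewrite <- exp_plus; f_equal; ring).
  assert (exp q' <= exp D) by (destruct H2 as [H2| ->]; [left; now apply exp_increasing|lra]).
  nra. }
intros Hp Hq. destruct (Rle_lt_dec p q) as [Hpq|Hpq].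
- assert (exp p <= exp q) by (destruct Hpq as [Hpq| ->]; [left; now apply exp_increasing|lra]).
  rewrite Rabs_left1, (Rabs_left1 (p - q)) by lra. generalize (H p q Hpq Hq); lra.
- assert (exp q < exp p) by now apply exp_increasing.
  rewrite Rabs_right, (Rabs_right (p - q)) by lra. apply H; lra.
Qed.

Lemma exp_le p q : p <= q -> exp p <= exp q.
Proof. intros [H| ->]; [left; now apply exp_increasing|lra]. Qed.

(* [V] is compared with its value at the last time [s] it was below [rho M]; after [s] the
   product of [V] with the integrating factor of [mu] cannot increase. *)
Lemma iss_core {n m : nat} (tsharp : R) (f : R -> vec n -> vec m -> vec n)
  (V Vt : R -> vec n -> R) (Vx : R -> vec n -> vec n) (rho mu : R -> R) (alpha beta : R)
  (HV : C1_with_partials tsharp V Vt Vx) (HVpos : forall t x, inJ tsharp t -> 0 <= V t x)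
  (Hrho : classK rho) (Hmu_pc : piecewise_continuous tsharp mu)
  (Hues : forall t0 t (pr : Riemann_integrable mu t0 t),
      inJ tsharp t0 -> t0 <= t -> RiemannInt pr <= - alpha * (t - t0) + beta)
  (Halpha : 0 <= alpha)
  (Hdiss : forall t x u, inJ tsharp t -> rho (norm u) <= V t x ->
     Vt t x + dot (Vx t x) (f t x u) <= mu t * V t x)
  (u : R -> vec m) (x : R -> vec n) (t0 t1 M : R) (N : R -> Prop) :
  inJ tsharp t0 -> t0 <= t1 -> 0 <= M -> abs_continuous x t0 t1 -> null_set N ->
  (forall t, t0 < t < t1 -> ~ N t ->
     (forall i, derivable_pt_lim (fun s => x s i) t (f t (x t) (u t) i)) /\ norm (u t) <= M) ->
  V t1 (x t1) <= exp (beta - alpha * (t1 - t0)) * V t0 (x t0) + exp beta * rho M.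
Proof.
unfold inJ in *. intros Ht0 Ht01 HM Hac HN Hsol.
destruct Hrho as [_ [Hrho0 [Hrhom _]]].
assert (Hcont := abs_continuous_cont_on x t0 t1 Hac).
destruct (tag_lipschitz_along tsharp V Vt Vx HV x t0 t1 Ht0 Ht01 Hcont) as [C [HC HCl]].
set (W := fun t => V t (x t)) in *.
assert (HWc : forall t, t0 <= t <= t1 -> forall e, 0 < e -> exists d, 0 < d /\
    forall s, t0 <= s <= t1 -> Rabs (s - t) < d -> Rabs (W s - W t) < e).
{ intros t Ht e He. destruct (HCl t Ht) as [d [Hd H]].
  set (e' := e / (2 * (C + 1))). assert (He' : 0 < e') by (apply Rdiv_lt_0_compat; lra).
  destruct (Hcont t Ht e' He') as [d' [Hd' H']].
  exists (Rmin d (Rmin d' e')); split; [repeat apply Rmin_glb_lt; lra|]. intros s Hs Hst.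
  assert (Rabs (s - t) < d /\ Rabs (s - t) < d' /\ Rabs (s - t) < e') as [K1 [K2 K3]]
    by (generalize (Rmin_l d (Rmin d' e')) (Rmin_r d (Rmin d' e')) (Rmin_l d' e') (Rmin_r d' e'); lra).
  specialize (H s Hs K1). specialize (H' s Hs K2). change (Rabs (W s - W t) <= C * (Rabs (s - t) + norm (vsub (x s) (x t)))) in H.
  assert (E : e' * (2 * (C + 1)) = e) by (unfold e'; field; lra).
  assert (C * (Rabs (s - t) + norm (vsub (x s) (x t))) <= C * (2 * e')) by (apply Rmult_le_compat_l; lra).
  lra. }
assert (HW0 : forall t, t0 <= t -> 0 <= W t) by (intros; apply HVpos; lra).
change (W t1 <= exp (beta - alpha * (t1 - t0)) * W t0 + exp beta * rho M).
assert (HrM : 0 <= rho M) by auto.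
(* The stability bound on the degenerate interval at [t0] reads [0 <= beta]. *)
assert (Hbeta : 0 <= beta).
{ assert (K := Hues t0 t0 (RiemannInt_P7 mu t0) ltac:(lra) ltac:(lra)).
  rewrite RiemannInt_P9 in K. lra. }
assert (He1 : 1 <= exp beta) by (rewrite <- exp_0; now apply exp_le).
assert (Hpos1 : 0 <= exp (beta - alpha * (t1 - t0)) * W t0).
{ apply Rmult_le_pos; [left; apply exp_pos|apply HW0; lra]. }
destruct (Rle_lt_dec (W t1) (rho M)) as [Hle|Hgt]; [nra|].
destruct (last_time_below W t0 t1 (rho M) Ht01 HWc Hgt) as [s [Hs [Hs1 Hs2]]].
assert (Hkey : W t1 <= exp (beta - alpha * (t1 - s)) * W s).
{ destruct (UES_primitive tsharp mu alpha beta s t1) as [Mu [B [N' [HB [HN' [Hl [Hd Hi]]]]]]];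
    auto; try lra.
  (* [D] bounds [- Mu] on the interval and [w] below bounds [W]. With the Lipschitz constant [B] of
     [Mu] they yield the constant of the product [W * exp (- Mu)] at its tags. *)
  set (D := Rabs (Mu s) + B * (t1 - s)).
  assert (HD : forall t, s <= t <= t1 -> - Mu t <= D).
  { intros t Ht. assert (K := Hl t s Ht ltac:(lra)). rewrite (Rabs_right (t - s)) in K by lra.
    assert (B * (t - s) <= B * (t1 - s)) by (apply Rmult_le_compat_l; lra).
    assert (K2 := Rle_abs (- (Mu t - Mu s))). rewrite Rabs_Ropp in K2.
    assert (K3 := Rle_abs (- Mu s)). rewrite Rabs_Ropp in K3. unfold D; lra. }
  destruct (cousin (fun r q => exists w, 0 <= w /\ forall t, r <= t <= q -> Rabs (W t) <= w) s t1)
    as [w [Hw0 Hw]]; [lra| | |].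
  { intros r q p _ _ [w1 [H1 K1]] [w2 [H2 K2]]. exists (w1 + w2); split; [lra|].
    intros t Ht. destruct (Rle_lt_dec t q); [assert (K := K1 t ltac:(lra))|assert (K := K2 t ltac:(lra))]; lra. }
  { intros t Ht. destruct (HWc t ltac:(lra) 1 ltac:(lra)) as [d [Hd1 K]]. exists d; split; auto.
    intros r q Hr Hrt Htq Hq Hrq. exists (Rabs (W t) + 1); split; [generalize (Rabs_pos (W t)); lra|].
    intros z Hz. assert (K1 := K z ltac:(lra) ltac:(apply Rabs_def1; lra)).
    assert (K2 := Rabs_triang_inv (W z) (W t)). lra. }
  assert (HY : W t1 * exp (- Mu t1) <= W s * exp (- Mu s)).
  { apply (ae_monotone_deriv x (fun t => W t * exp (- Mu t)) (fun t => N t \/ N' t) s t1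
      (C * exp D + w * (exp D * B))); try lra.
    - assert (0 < exp D) by apply exp_pos.
      apply Rplus_le_le_0_compat; repeat apply Rmult_le_pos; lra.
    - apply abs_continuous_sub with t0 t1; auto; lra.
    - now apply null_set_union.
    - intros t Ht. destruct (HCl t ltac:(lra)) as [d [Hd1 K]]. exists d; split; auto.
      intros q Hq Hqt. specialize (K q ltac:(lra) Hqt).
      change (Rabs (W q - W t) <= C * (Rabs (q - t) + norm (vsub (x q) (x t)))) in K.
      assert (L1 := exp_lipschitz D (- Mu q) (- Mu t) (HD q Hq) (HD t Ht)).
      replace (- Mu q - - Mu t) with (- (Mu q - Mu t)) in L1 by ring. rewrite Rabs_Ropp in L1.
      assert (L2 := Hl q t Hq Ht).
      assert (L3 : exp (- Mu q) <= exp D) by (apply exp_le; auto).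
      assert (L4 := Hw t Ht). assert (P := exp_pos (- Mu q)). assert (P' := exp_pos D).
      set (nq := norm (vsub (x q) (x t))) in *. assert (0 <= nq) by apply norm_nonneg.
      assert (Q := Rabs_pos (q - t)).
      replace (W q * exp (- Mu q) - W t * exp (- Mu t)) with
        ((W q - W t) * exp (- Mu q) + W t * (exp (- Mu q) - exp (- Mu t))) by ring.
      eapply Rle_trans; [apply Rabs_triang|]. rewrite !Rabs_mult, (Rabs_right (exp (- Mu q))) by lra.
      assert (T1 : Rabs (W q - W t) * exp (- Mu q) <= C * (Rabs (q - t) + nq) * exp D).
      { apply Rmult_le_compat; auto using Rabs_pos; lra. }
      assert (T2 : Rabs (W t) * Rabs (exp (- Mu q) - exp (- Mu t)) <= w * (exp D * (B * Rabs (q - t)))).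
      { apply Rmult_le_compat; auto using Rabs_pos. eapply Rle_trans; [exact L1|].
        apply Rmult_le_compat_l; lra. }
      assert (0 <= w * (exp D * B) * nq) by (repeat apply Rmult_le_pos; lra).
      lra.
    - intros t Ht HNt. destruct (Hsol t ltac:(lra) ltac:(tauto)) as [Hx Hu].
      exists ((Vt t (x t) + dot (Vx t (x t)) (f t (x t) (u t))) * exp (- Mu t)
              + W t * (exp (- Mu t) * (- mu t))). split.
      (* After [s] one has [rho (norm (u t)) <= rho M < W t], so the dissipation inequality is
         available and makes the derivative of the product nonpositive. *)
      + assert (K := Hdiss t (x t) (u t) ltac:(lra)).
        assert (rho (norm (u t)) <= V t (x t)).
        { apply Rle_trans with (rho M); [apply Hrhom; auto using norm_nonneg|].
          left; apply (Hs2 t); lra. }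
        specialize (K H). assert (P := exp_pos (- Mu t)). unfold W. nra.
      + apply (derivable_pt_lim_mult W (fun t => exp (- Mu t))).
        * apply (derivable_along tsharp V Vt Vx HV x t (f t (x t) (u t))); [lra|auto].
        * apply (derivable_pt_lim_comp (fun t => - Mu t) exp).
          -- apply derivable_pt_lim_opp. apply Hd; [lra|tauto].
          -- apply derivable_pt_lim_exp. }
  assert (Hi' := Hi s t1 ltac:(lra) ltac:(lra) ltac:(lra)).
  assert (P1 := exp_pos (Mu t1)).
  assert (HY' : W t1 <= W s * exp (Mu t1 - Mu s)).
  { apply Rmult_le_compat_r with (r := exp (Mu t1)) in HY; [|lra].
    rewrite !Rmult_assoc, <- !exp_plus in HY.
    replace (- Mu t1 + Mu t1) with 0 in HY by ring. rewrite exp_0, Rmult_1_r in HY.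
    replace (- Mu s + Mu t1) with (Mu t1 - Mu s) in HY by ring. exact HY. }
  assert (exp (Mu t1 - Mu s) <= exp (beta - alpha * (t1 - s))) by (apply exp_le; lra).
  rewrite Rmult_comm in HY'. assert (0 <= W s) by (apply HW0; lra). nra. }
(* Each alternative for [s] is paid for by one term of the bound; in the second the decay over
   [t1 - s] is given up. *)
destruct Hs1 as [->|Hs1].
- assert (0 <= exp beta * rho M) by (apply Rmult_le_pos; lra). lra.
- assert (exp (beta - alpha * (t1 - s)) <= exp beta).
  { apply exp_le. assert (0 <= alpha * (t1 - s)) by (apply Rmult_le_pos; lra). lra. }
  assert (0 <= W s) by (apply HW0; lra).
  assert (exp (beta - alpha * (t1 - s)) * W s <= exp beta * rho M).
  { apply Rmult_le_compat; auto. left; apply exp_pos. }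
  lra.
Qed.

(** * Comparison functions *)

Lemma choice_fun {A B : Type} (P : A -> B -> Prop) :
  (forall a, exists b, P a b) -> exists g : A -> B, forall a, P a (g a).
Proof.
intros H. exists (fun a => proj1_sig (constructive_indefinite_description _ (H a))).
intros a. apply (proj2_sig (constructive_indefinite_description _ (H a))).
Qed.

(** [g] is the inverse of [a] on the half-line, where the intermediate value theorem makes [a] onto.
    It is exported as a rule turning an upper bound of [a s] into one of [s], the way [V] bounds the
    state. *)
Lemma classKinf_inverse (a : R -> R) : classKinf a ->
  exists g, classK g /\ forall s y, 0 <= s -> a s <= y -> s <= g y.
Proof.
intros [Hc [H0 [Hm [Ha0 Hinf]]]].
assert (Hmle : forall s s', 0 <= s -> s <= s' -> a s <= a s').
{ intros s s' Hs [Hlt| ->]; [left; apply Hm; auto|lra]. }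
assert (Hex : forall y, exists s, 0 <= s /\ (0 <= y -> a s = y)).
{ intros y. destruct (Rle_lt_dec 0 y) as [Hy|Hy]; [|exists 0; split; lra].
  destruct (Hinf y) as [b [Hb Hab]].
  (* Composition with [Rabs] turns continuity on the half-line into continuity on all of [R], as the
     intermediate value theorem demands. *)
  destruct (IVT_gen (fun s => a (Rabs s)) 0 b y) as [s [Hs E]].
  - intros t e He. destruct (Hc (Rabs t) (Rabs_pos t) e He) as [d [Hd H]].
    exists d; split; [lra|]. intros s [_ Hs]. apply H; [apply Rabs_pos|].
    eapply Rle_lt_trans; [apply Rabs_triang_inv2|exact Hs].
  - rewrite Rabs_R0, (Rabs_right b), Ha0 by lra. rewrite Rmin_left, Rmax_right by lra. lra.
  - exists (Rabs s); split; [apply Rabs_pos|auto]. }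
destruct (choice_fun _ Hex) as [g Hg].
assert (Hg0 : forall y, 0 <= g y) by apply Hg.
assert (Hga : forall y, 0 <= y -> a (g y) = y) by (intros; now apply Hg).
assert (Hinv : forall s y, 0 <= s -> 0 <= y -> a s <= y -> s <= g y).
{ intros s y Hs Hy Hsy. apply Rnot_lt_le; intros Hlt.
  apply Hm in Hlt; auto. rewrite Hga in Hlt; lra. }
assert (Hinv2 : forall s y, 0 <= s -> 0 <= y -> y < a s -> g y < s).
{ intros s y Hs Hy Hsy. apply Rnot_le_lt; intros Hle.
  apply Hmle in Hle; auto. rewrite Hga in Hle; lra. }
assert (Hinv3 : forall s y, 0 <= s -> 0 <= y -> a s < y -> s < g y).
{ intros s y Hs Hy Hsy. apply Rnot_le_lt; intros Hle.
  apply Hmle in Hle; auto. rewrite Hga in Hle; lra. }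
exists g. split.
2:{ intros s y Hs Hsy. apply Hinv; auto. apply Rle_trans with (a s); auto. }
split; [|split; [auto|split]].
- intros y Hy e He.
  assert (Hup : y < a (g y + e)) by (rewrite <- (Hga y Hy) at 1; apply Hm; auto; lra).
  (* If [g y - e] is negative, nothing is known of [a] there; the lower bound is then just
     [0 <= g y']. *)
  destruct (Rle_lt_dec e (g y)) as [Hge|Hge].
  + assert (Hlo : a (g y - e) < y) by (rewrite <- (Hga y Hy) at 2; apply Hm; lra).
    exists (Rmin (a (g y + e) - y) (y - a (g y - e))); split; [apply Rmin_glb_lt; lra|].
    intros y' Hy' Hd.
    generalize (Rmin_l (a (g y + e) - y) (y - a (g y - e))) (Rmin_r (a (g y + e) - y) (y - a (g y - e))); intros.
    assert (Hd1 : Rabs (y' - y) < a (g y + e) - y) by lra. apply Rabs_def2 in Hd1.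
    assert (Hd2 : Rabs (y' - y) < y - a (g y - e)) by lra. apply Rabs_def2 in Hd2.
    assert (g y' < g y + e) by (apply Hinv2; auto; [generalize (Hg0 y)|]; lra).
    assert (g y - e < g y') by (apply Hinv3; auto; lra).
    apply Rabs_def1; lra.
  + exists (a (g y + e) - y); split; [lra|]. intros y' Hy' Hd. apply Rabs_def2 in Hd.
    assert (g y' < g y + e) by (apply Hinv2; auto; [generalize (Hg0 y)|]; lra).
    generalize (Hg0 y'); intros. apply Rabs_def1; lra.
- intros s s' Hs Hss'. apply Hinv; auto; [lra|]. rewrite Hga; auto.
- generalize (Hg0 0); intros. destruct (Rle_lt_dec (g 0) 0); [lra|].
  apply Hm in r; [|lra]. rewrite Ha0, Hga in r; lra.
Qed.

Lemma classK_comp_scal (g a : R -> R) (c : R) :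
  classK g -> classK a -> 0 <= c -> classK (fun s => g (c * a s)).
Proof.
intros [Gc [G0 [Gm Gz]]] [Ac [A0 [Am Az]]] Hc.
assert (Hp : forall s, 0 <= s -> 0 <= c * a s) by (intros; apply Rmult_le_pos; auto).
split; [|split; [|split]].
- intros s Hs e He. destruct (Gc (c * a s) (Hp s Hs) e He) as [d [Hd H]].
  destruct (Ac s Hs (d / (c + 1))) as [d' [Hd' H']]; [apply Rdiv_lt_0_compat; lra|].
  exists d'; split; auto. intros s' Hs' Hss'. apply H; auto. specialize (H' s' Hs' Hss').
  replace (c * a s' - c * a s) with (c * (a s' - a s)) by ring.
  rewrite Rabs_mult, (Rabs_right c) by lra.
  assert (E : d / (c + 1) * (c + 1) = d) by (field; lra).
  generalize (Rabs_pos (a s' - a s)); nra.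
- auto.
- intros s s' Hs Hss'. apply Gm; auto. apply Rmult_le_compat_l; auto.
- now rewrite Az, Rmult_0_r.
Qed.

Lemma classKinf_classK a : classKinf a -> classK a.
Proof.
intros [Hc [H0 [Hm [Ha0 _]]]]. repeat split; auto.
intros s s' Hs [Hlt| ->]; [left; apply Hm; auto|lra].
Qed.

Lemma classKL_exp (g a : R -> R) (alpha beta : R) :
  classK g -> classK a -> 0 < alpha ->
  classKL (fun s t => g (2 * exp (beta - alpha * t) * a s)).
Proof.
intros Hg Ha Halpha. split; [|split].
- intros t _. apply classK_comp_scal; auto. generalize (exp_pos (beta - alpha * t)); lra.
- intros s t t' Hs Ht Htt'. destruct Hg as [_ [_ [Gm _]]]. destruct Ha as [_ [A0 _]].
  specialize (A0 s Hs). assert (P := exp_pos (beta - alpha * t')).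
  assert (exp (beta - alpha * t') <= exp (beta - alpha * t)).
  { apply exp_le. assert (alpha * t <= alpha * t') by (apply Rmult_le_compat_l; lra). lra. }
  apply Gm; nra.
- intros s Hs e He. destruct Hg as [Gc [G0 [Gm Gz]]]. destruct Ha as [_ [A0 _]].
  specialize (A0 s Hs). destruct (Gc 0 ltac:(lra) e He) as [d [Hd H]].
  set (K := 2 * exp beta * a s).
  assert (HK : 0 <= K) by (unfold K; generalize (exp_pos beta); nra).
  (* From this time on [K <= alpha * t * d], which is less than [exp (alpha * t) * d] because
     [1 + y <= exp y]. *)
  exists (K / (alpha * d)); split.
  { apply Rmult_le_pos; auto. left; apply Rinv_0_lt_compat; nra. }
  intros t Ht.
  assert (E : 2 * exp (beta - alpha * t) * a s = K * / exp (alpha * t)).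
  { unfold K, Rminus. rewrite exp_plus, exp_Ropp. ring. }
  rewrite E. clear E.
  assert (Pe := exp_pos (alpha * t)).
  assert (HKt : K <= alpha * t * d).
  { apply Rmult_le_compat_r with (r := alpha * d) in Ht; [|nra].
    replace (K / (alpha * d) * (alpha * d)) with K in Ht by (field; lra). lra. }
  assert (Hlt : K * / exp (alpha * t) < d).
  { apply Rmult_lt_reg_r with (exp (alpha * t)); auto. rewrite Rmult_assoc, Rinv_l by lra.
    generalize (exp_ineq1_le (alpha * t)); nra. }
  assert (Hpos : 0 <= K * / exp (alpha * t)) by (apply Rmult_le_pos; auto; left; now apply Rinv_0_lt_compat).
  specialize (H (K * / exp (alpha * t)) Hpos).
  rewrite Gz, !Rminus_0_r in H. apply H. rewrite Rabs_right; lra.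
Qed.

(** A sum is at most twice its larger term. This replaces subadditivity, which a class K function
    may lack. *)
Lemma classK_sum_le (g : R -> R) p q : classK g -> 0 <= p -> 0 <= q ->
  g (p + q) <= g (2 * p) + g (2 * q).
Proof.
intros [_ [G0 [Gm _]]] Hp Hq.
assert (0 <= g (2 * p)) by (apply G0; lra). assert (0 <= g (2 * q)) by (apply G0; lra).
destruct (Rle_lt_dec p q).
- assert (g (p + q) <= g (2 * q)) by (apply Gm; lra). lra.
- assert (g (p + q) <= g (2 * p)) by (apply Gm; lra). lra.
Qed.

(** * Open sets and compactness in coordinates *)

(** Openness in the maximum norm, which is compatible with adding a coordinate and so suits
    induction on the dimension. *)
Definition open_coord {n} (U : vec n -> Prop) : Prop :=
  forall w, U w -> exists d, 0 < d /\ forall w', (forall i, Rabs (w' i - w i) < d) -> U w'.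

Definition vcons {n} (s : R) (w : vec n) : vec (S n) :=
  fun i => Fin.caseS' i (fun _ => R) s w.
Definition vtail {n} (w : vec (S n)) : vec n := fun i => w (Fin.FS i).

Lemma vcons_eta {n} (w : vec (S n)) : vcons (w Fin.F1) (vtail w) = w.
Proof.
apply functional_extensionality; intros i. unfold vcons, vtail.
apply (Fin.caseS' i); reflexivity.
Qed.

Lemma vcons_close {n} (s s' : R) (w w' : vec n) d :
  Rabs (s' - s) < d -> (forall i, Rabs (w' i - w i) < d) ->
  forall i, Rabs (vcons s' w' i - vcons s w i) < d.
Proof. intros Hs Hw i. unfold vcons. apply (Fin.caseS' i); auto. Qed.

(* The interior of the set of [w] whose whole fibre over the interval lies in [U]; a union of
   countably many products of such intervals and interiors exhausts [U]. *)
Definition slab_interior {n} (U : vec (S n) -> Prop) (q d : R) (w : vec n) : Prop :=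
  exists e, 0 < e /\ forall w', (forall i, Rabs (w' i - w i) < e) ->
    forall s, Rabs (s - q) < d -> U (vcons s w').

Lemma slab_interior_open {n} (U : vec (S n) -> Prop) q d : open_coord (slab_interior U q d).
Proof.
intros w [e [He H]]. exists (e / 2); split; [lra|]. intros w' Hw'.
exists (e / 2); split; [lra|]. intros w'' Hw''. apply H. intros i.
specialize (Hw' i); specialize (Hw'' i).
replace (w'' i - w i) with ((w'' i - w' i) + (w' i - w i)) by ring.
eapply Rle_lt_trans; [apply Rabs_triang|lra].
Qed.

Lemma slab_interior_self {n} (U : vec (S n) -> Prop) q d w s :
  slab_interior U q d w -> Rabs (s - q) < d -> U (vcons s w).
Proof.
intros [e [He H]] Hs. apply H; auto. intros i. rewrite Rminus_diag_eq, Rabs_R0; auto.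
Qed.

(* Compactness of the box, phrased for an ideal [L] of subsets: one Cousin argument in the first
   coordinate, applied to the ideal of the sets [S] such that a slab over [S] belongs to [L]. *)
Lemma box_ideal (n : nat) : forall (L : (vec n -> Prop) -> Prop) (M : R),
  0 <= M ->
  (forall P Q : vec n -> Prop, (forall w, P w -> Q w) -> L Q -> L P) ->
  (forall P Q : vec n -> Prop, L P -> L Q -> L (fun w => P w \/ Q w)) ->
  (forall w, (forall i, Rabs (w i) <= M) ->
     exists d, 0 < d /\ L (fun w' => forall i, Rabs (w' i - w i) < d)) ->
  L (fun w => forall i, Rabs (w i) <= M).
Proof.
induction n as [|n IH]; intros L M HM Hdown Hunion Hloc.
- destruct (Hloc (fun _ => 0)) as [d [Hd H]]; [intros i; inversion i|].
  apply Hdown with (2 := H). intros w _ i; inversion i.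
- assert (HQ : L (fun w => - M <= w Fin.F1 <= M /\ forall i, Rabs (vtail w i) <= M)).
  { apply (cousin (fun r s => L (fun w => r <= w Fin.F1 <= s /\ forall i, Rabs (vtail w i) <= M)));
      [lra| |].
    - intros r s t _ _ H1 H2. apply Hdown with (2 := Hunion _ _ H1 H2).
      intros w [Hw Hw']. destruct (Rle_lt_dec (w Fin.F1) s); [left|right]; split; auto; lra.
    - intros c Hc.
      assert (H : exists d, 0 < d /\
        L (fun w => Rabs (w Fin.F1 - c) < d /\ forall i, Rabs (vtail w i) <= M)).
      { apply (IH (fun S => exists d, 0 < d /\ L (fun w => Rabs (w Fin.F1 - c) < d /\ S (vtail w))));
          auto.
        - intros P Q HPQ [d [Hd H]]. exists d; split; auto.
          apply Hdown with (2 := H). intros w [H1 H2]; auto.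
        - intros P Q [d [Hd H]] [d' [Hd' H']]. exists (Rmin d d'); split; [now apply Rmin_glb_lt|].
          apply Hdown with (2 := Hunion _ _ H H'). intros w [H1 H2].
          generalize (Rmin_l d d') (Rmin_r d d'); intros.
          destruct H2; [left|right]; split; auto; lra.
        - intros w Hw. destruct (Hloc (vcons c w)) as [d [Hd H]].
          { intros i. apply (Fin.caseS' i); [simpl; apply Rabs_le; lra|apply Hw]. }
          exists d; split; auto. exists d; split; auto.
          apply Hdown with (2 := H). intros w' [H1 H2] i.
          rewrite <- (vcons_eta w'). now apply vcons_close. }
      destruct H as [d [Hd H]]. exists d; split; auto. intros r s _ Hrc Hcs _ Hrs.
      apply Hdown with (2 := H). intros w [Hw Hw']; split; auto. apply Rabs_def1; lra. }
  apply Hdown with (2 := HQ). intros w Hw; split; [|intros i; apply Hw].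
  specialize (Hw Fin.F1). apply Rabs_le_between in Hw; lra.
Qed.

Definition jointly_continuous {m : nat} (t0 : R) (F : R -> vec m -> R) : Prop :=
  forall t w, t0 <= t -> forall e, 0 < e -> exists d, 0 < d /\
    forall t' w', t0 <= t' -> Rabs (t' - t) < d -> norm (vsub w' w) < d ->
      Rabs (F t' w' - F t w) < e.

Lemma jointly_continuous_coord {m} t0 (F : R -> vec m -> R) : jointly_continuous t0 F ->
  forall t w, t0 <= t -> forall e, 0 < e -> exists d, 0 < d /\
    forall t' w', t0 <= t' -> Rabs (t' - t) < d -> (forall i, Rabs (w' i - w i) < d) ->
      Rabs (F t' w' - F t w) < e.
Proof.
intros HF t w Ht e He. destruct (HF t w Ht e He) as [d [Hd H]].
assert (Hn : 0 < INR m + 1) by (generalize (pos_INR m); lra).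
exists (d / (INR m + 1)); split; [now apply Rdiv_lt_0_compat|].
assert (E : d / (INR m + 1) * (INR m + 1) = d) by (field; lra).
assert (P : 0 < d / (INR m + 1)) by now apply Rdiv_lt_0_compat.
intros t' w' Ht' H1 H2. apply H; auto.
- generalize (pos_INR m); nra.
- eapply Rle_lt_trans; [apply norm_le_coords with (c := d / (INR m + 1));
    intros i; left; apply H2|]. lra.
Qed.

(** Compactness in two stages: at a fixed time [box_ideal] is applied to the ideal of sets on which
    [F] is bounded for all nearby times, and [cousin] then joins the times. *)
Lemma jointly_continuous_bounded {m} t0 (F : R -> vec m -> R) b M : jointly_continuous t0 F ->
  exists C, forall t w, t0 <= t <= b -> norm w <= M -> Rabs (F t w) <= C.
Proof.
intros HF. assert (HF' := jointly_continuous_coord t0 F HF).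
destruct (Rle_lt_dec t0 b) as [Hb|Hb]; [|exists 0; intros; lra].
destruct (Rle_lt_dec 0 M) as [HM|HM].
2:{ exists 0; intros t w _ Hw. generalize (norm_nonneg m w); lra. }
assert (HQ : exists C, forall t w, t0 <= t <= b -> (forall i, Rabs (w i) <= M) -> Rabs (F t w) <= C).
{ apply (cousin (fun r s => exists C, forall t w, r <= t <= s -> (forall i, Rabs (w i) <= M) ->
     Rabs (F t w) <= C)); auto.
  - intros r s t _ _ [C1 H1] [C2 H2]. exists (Rmax C1 C2); intros q w Hq Hw.
    destruct (Rle_lt_dec q s).
    + eapply Rle_trans; [apply H1; auto; lra|apply Rmax_l].
    + eapply Rle_trans; [apply H2; auto; lra|apply Rmax_r].
  - intros t Ht.
    assert (H : exists d C, 0 < d /\ forall t' w, t0 <= t' -> Rabs (t' - t) < d ->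
      (forall i, Rabs (w i) <= M) -> Rabs (F t' w) <= C).
    { apply (box_ideal m (fun S => exists d C, 0 < d /\ forall t' w, t0 <= t' ->
        Rabs (t' - t) < d -> S w -> Rabs (F t' w) <= C)); auto.
      - intros P Q HPQ [d [C [Hd H]]]. exists d, C; split; auto.
      - intros P Q [d [C [Hd H]]] [d' [C' [Hd' H']]]. exists (Rmin d d'), (Rmax C C').
        split; [now apply Rmin_glb_lt|].
        generalize (Rmin_l d d') (Rmin_r d d'); intros K1 K2 t' w Ht' H1 [H2|H2].
        + eapply Rle_trans; [apply H; auto; lra|apply Rmax_l].
        + eapply Rle_trans; [apply H'; auto; lra|apply Rmax_r].
      - intros w _. destruct (HF' t w ltac:(lra) 1 ltac:(lra)) as [d [Hd H]].
        exists d; split; auto. exists d, (Rabs (F t w) + 1); split; auto.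
        intros t' w' Ht' H1 H2. specialize (H t' w' Ht' H1 H2).
        generalize (Rabs_triang_inv (F t' w') (F t w)); lra. }
    destruct H as [d [C [Hd H]]]. exists d; split; auto. intros r s Hr Hrt Hts Hs Hrs.
    exists C. intros q w Hq Hw. apply H; auto; [lra|apply Rabs_def1; lra]. }
destruct HQ as [C HC]. exists C; intros t w Ht Hw. apply HC; auto.
intros i. eapply Rle_trans; [apply coord_le_norm|auto].
Qed.

(** * Primitives of measurable functions *)

Module Lebesgue.
Import all_boot all_order all_algebra.
Import all_classical all_reals all_analysis measurable_realfun Rstruct Rstruct_topology.
Import Order.TTheory GRing.Theory Num.Theory numFieldNormedType.Exports.
Set Implicit Arguments.
Unset Strict Implicit.
Unset Printing Implicit Defensive.
Local Open Scope classical_set_scope.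
Local Open Scope ring_scope.

Lemma bounded_itv_integrable (Rt : realType) (h : Rt -> Rt) (a b : Rt) (C : Rt) :
  measurable_fun [set: Rt] h ->
  (forall t, a <= t <= b -> `|h t| <= C) ->
  (@lebesgue_measure Rt).-integrable `[a, b] (EFin \o h).
Proof.
move=> mh hC; apply: measurable_bounded_integrable => //.
- by rewrite /= lebesgue_measure_itv; case: ifP => _ //=; rewrite -EFinB ltry.
- exact: measurable_funTS.
- rewrite /bounded_near; exists C; split; first exact: num_real.
  move=> M CM t /=; rewrite in_itv /= => tab.
  by apply: (le_trans (hC t tab)); exact: ltW.
Qed.

(** To the left of [a] no bound on [h] is given, so [h] is replaced by zero there. The result [g] is
    locally integrable on the whole line, and the primitive is differentiable almost everywhere by
    Lebesgue's theorem. *)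
Lemma lebesgue_primitive (Rt : realType) (h : Rt -> Rt) (a : Rt) :
  measurable_fun [set: Rt] h ->
  (forall b, exists C : Rt, forall t, a <= t <= b -> `|h t| <= C) ->
  exists H : Rt -> Rt, [/\ H a = 0,
    forall b, exists C : Rt, forall r s, a <= r -> r <= s -> s <= b -> `|H s - H r| <= C * (s - r) &
    {ae (@lebesgue_measure Rt), forall t, a < t -> derivable H t 1 /\ derive1 H t = h t}].
Proof.
move=> mh bh.
pose mu := @lebesgue_measure Rt.
pose g := h \_ (`[a, +oo[ : set Rt).
have gE t : a <= t -> g t = h t by move=> at_; rewrite /g patchE mem_set //= in_itv /= at_.
have g0 t : t < a -> g t = 0.
  by move=> ta; rewrite /g patchE memNset //= in_itv /= andbT leNgt ta.
have mg : measurable_fun [set: Rt] g.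
  apply/(measurable_restrictT _ _).1; [exact: measurable_itv|exact: measurable_funTS].
have bg b : exists C : Rt, 0 <= C /\ forall t, t <= b -> `|g t| <= C.
  have [C hC] := bh b; exists (Num.max C 0); split; first by rewrite le_max lexx orbT.
  move=> t tb; case: (leP a t) => [at_|ta].
    by rewrite gE // le_max hC ?at_ //.
  by rewrite g0 // normr0 le_max lexx orbT.
have ig r s : mu.-integrable `[r, s] (EFin \o g).
  have [C [_ gC]] := bg s.
  apply: (@bounded_itv_integrable _ _ _ _ C) => // t /andP[_ ts]; exact: gC.
pose H x := (\int[mu]_(t in `[a, x]) g t)%R.
exists H; split.
- by rewrite /H set_itv1 Rintegral_set1.
- move=> b; have [C [C0 gC]] := bg b; exists C => r s ar rs sb.
  rewrite /H.
  have -> : (\int[mu]_(t in `[a, s]) g t - \int[mu]_(t in `[a, r]) g t =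
             \int[mu]_(t in `]r, s]) g t)%R.
    by rewrite (@Rintegral_itvB _ g (BLeft a) (BRight s) r).
  have irs : mu.-integrable `]r, s] (EFin \o g).
    apply: (integrableS _ _ _ (ig r s)) => //.
    by apply: subset_itvr; rewrite bnd_simp.
  rewrite (le_trans (le_normr_Rintegral _ irs)) //.
  have -> : C * (s - r) = (\int[mu]_(t in `]r, s]) C)%R.
    rewrite Rintegral_cst //= lebesgue_measure_itv /= lte_fin.
    by move: rs; rewrite le_eqVlt => /predU1P[->|->//]; rewrite ltxx subrr.
  have ic : mu.-integrable `]r, s] (EFin \o cst C).
    apply: (integrableS _ _ _ (@bounded_itv_integrable _ (cst C) r s `|C| _ _)) => //.
    by apply: subset_itvr; rewrite bnd_simp.
  apply: (le_Rintegral _ _ ic) => //.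
  + exact: (integrable_abse irs).
  + move=> t /=; rewrite in_itv /= => /andP[_ ts]; apply: gC; exact: le_trans sb.
- have lg : locally_integrable [set: Rt] g.
    split => //; first exact: openT.
    move=> K _ cK.
    have [M [_ KM]] := compact_bounded cK.
    have bK : K `<=` `[- (M + 1), M + 1].
      move=> t Kt /=; rewrite in_itv /= -ler_norml; apply: KM => //.
      by rewrite ltrDl.
    have iK : mu.-integrable K (EFin \o g).
      by apply: (@integrableS _ _ _ mu _ _ _ (measurable_itv _) _ bK (ig _ _)); exact: compact_measurable.
    by have /integrableP[_] := iK.
  have [A [mA A0 sA]] := @FTC1 Rt g (BLeft a) (fun y => ig a y) lg.
  exists A; split => // t nH; apply: sA => Ht; apply: nH => at_.
  have [|d e] := Ht; first by rewrite lte_fin.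
  by split => //; rewrite e gE // ltW.
Qed.

Lemma negligible_open_cover (Rt : realType) (N : set Rt) (e : Rt) :
  (@lebesgue_measure Rt).-negligible N -> 0 < e ->
  exists a b : nat -> Rt, [/\ forall k, a k <= b k,
    forall t, N t -> exists k, a k < t < b k &
    forall K, \sum_(0 <= k < K) (b k - a k) <= e].
Proof.
move=> [A [mA A0 NA]] e0.
have : (ereal_inf [set \sum_(0 <= k <oo) wlength idfun (F k) |
    F in open_itv_cover A] < e%:E)%E.
  by rewrite -outer_measure_open_itv_cover [ltLHS]A0 lte_fin.
move=> /ereal_inf_lt[_ [F [oF AF] <-] Fe].
have /choice[ab abF] : forall k, exists ab : Rt * Rt, F k = [set` Interval (BRight ab.1) (BLeft ab.2)] := oF.
(* An empty interval of the cover may have its ends in the wrong order; the maximum restores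
   [a k <= b k] and agrees with the length zero. *)
exists (fun k => (ab k).1), (fun k => Num.max (ab k).1 (ab k).2); split.
- by move=> k; rewrite le_max lexx.
- move=> t /NA /AF [k _]; rewrite abF /= in_itv /= => /andP[h1 h2].
  by exists k; rewrite h1 /= lt_max h2 orbT.
- move=> K.
  have E k : wlength idfun (F k) = (Num.max (ab k).1 (ab k).2 - (ab k).1)%:E.
    rewrite abF wlength_itv /= lte_fin; case: ltP => h.
      by rewrite EFinB.
    by rewrite subrr.
  rewrite -lee_fin -sumEFin; apply: le_trans (ltW Fe).
  under eq_bigr do rewrite -E.
  apply: nneseries_lim_ge => k _ _; exact: wlength_ge0.
Qed.

(** Negligibility asks for a measurable null superset: the intersection over [n] of the unions of
    the covers of total length at most [1 / (n + 1)]. *)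
Lemma open_cover_negligible (Rt : realType) (N : set Rt) :
  (forall e : Rt, 0 < e -> exists a b : nat -> Rt, [/\ forall k, a k <= b k,
    forall t, N t -> exists k, a k < t < b k &
    forall K, \sum_(0 <= k < K) (b k - a k) <= e]) ->
  (@lebesgue_measure Rt).-negligible N.
Proof.
move=> cN.
have cN' n : exists U : set Rt, [/\ measurable U, N `<=` U &
    (lebesgue_measure U <= (n.+1%:R^-1 : Rt)%:E)%E].
  have [|a [b [ab Nab sab]]] := cN n.+1%:R^-1; first by rewrite invr_gt0.
  exists (\bigcup_k [set` Interval (BRight (a k)) (BLeft (b k))]); split.
  - by apply: bigcup_measurable => k _; exact: measurable_itv.
  - by move=> t /Nab[k kt]; exists k => //=; rewrite in_itv.
  - apply: (le_trans (measure_sigma_subadditive (F := fun k => [set` Interval (BRight (a k)) (BLeft (b k))]) (@lebesgue_measure Rt) _ _ _)) => //.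
      by apply: bigcup_measurable => k _; exact: measurable_itv.
    apply: lime_le; first exact: is_cvg_nneseries.
    apply: nearW => K.
    rewrite (eq_bigr (fun k => (b k - a k)%:E)); last first.
      move=> k _; rewrite /= (lebesgue_measure_itv (Interval (BRight (a k)) (BLeft (b k)))) /= lte_fin.
      move: (ab k); rewrite le_eqVlt => /predU1P[->|->]; last by rewrite EFinB.
      by rewrite ltxx subrr.
    by rewrite sumEFin lee_fin.
have [U HU] := choice cN'.
exists (\bigcap_n U n); split.
- by apply: bigcap_measurable => // k _; have [] := HU k.
- apply/eqP; rewrite eq_le measure_ge0 andbT; apply/lee_addgt0Pr => e e0; rewrite add0e.
  have [n ne] : exists n : nat, n.+1%:R^-1 < e.
    exists (Num.truncn e^-1); rewrite invf_plt ?posrE //; exact: truncnS_gt.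
  have [mU _ Un] := HU n.
  apply: (@le_trans _ _ (lebesgue_measure (U n))).
    apply: le_measure; rewrite ?inE //.
      by apply: bigcap_measurable => // k _; have [] := HU k.
    exact: bigcap_inf.
  by apply: (le_trans Un); rewrite lee_fin ltW.
- by move=> t Nt n _; have [_ + _] := HU n; apply.
Qed.

(** * From interval covers to Lebesgue measure *)

Local Notation null_set := Defs.null_set.
(* A realType whose carrier is Stdlib's [R]: the Borel structure is inferred from the sort of a
   realType, not from the bare type [R]. *)
Definition RT : realType := R.
Local Notation mu := (@lebesgue_measure RT).

Lemma outer_leE (E : R -> Prop) (e : R) : outer_le E e <->
  exists a b : nat -> R, [/\ forall k, a k <= b k,
    forall t, E t -> exists k, a k < t < b k &
    forall K, \sum_(0 <= k < K) (b k - a k) <= e].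
Proof.
split.
- move=> [a [b [H1 [H2 H3]]]]; exists a, b; split.
  + by move=> k; apply/RleP.
  + by move=> t /H2[k [/RltP h1 /RltP h2]]; exists k; rewrite h1.
  (* [sum_f_R0] up to [K] has [K + 1] terms, so the empty sum has no counterpart; [0 <= e] follows
     from the first term. *)
  + case=> [|K].
      rewrite big_geq //; apply: le_trans (_ : b 0%N - a 0%N <= _).
        by rewrite subr_ge0; apply/RleP.
      by have /RleP := H3 0%N.
    by have /RleP := H3 K; rewrite sum_f_R0E.
- move=> [a [b [H1 H2 H3]]]; exists a, b; split; [|split].
  + by move=> k; apply/RleP.
  + by move=> t /H2[k /andP[/RltP h1 /RltP h2]]; exists k.
  + by move=> K; apply/RleP; rewrite sum_f_R0E.
Qed.

Lemma null_setE (E : R -> Prop) : null_set E <-> mu.-negligible (E : set RT).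
Proof.
split.
- by move=> nE; apply: open_cover_negligible => e e0; apply/outer_leE/nE/RltP.
- by move=> nE e /RltP e0; apply/outer_leE; exact: negligible_open_cover.
Qed.

Lemma null_set_bigcup (E : nat -> R -> Prop) :
  (forall k, null_set (E k)) -> null_set (fun t => exists k, E k t).
Proof.
move=> nE; apply/null_setE.
have := @negligible_bigcup _ _ _ mu E (fun k => (null_setE (E k)).1 (nE k)).
apply: negligibleS => t [k Ekt]; by exists k.
Qed.

Lemma open_R_open (G : R -> Prop) : open_R G -> open (G : set RT).
Proof.
move=> oG; rewrite openE => t /oG[d [/RltP d0 H]].
apply/nbhs_ballP; exists d => // s /=; rewrite /ball /= distrC -RabsE => h.
by apply: H; apply/RltP.
Qed.

(** The hull [B] is the intersection of open supersets whose excess over [E] has outer measure at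
    most [1 / (n + 1)]. *)
Lemma measurable_set_borel (E : R -> Prop) : measurable_set E ->
  exists B : set RT, [/\ measurable B, (forall t, E t -> B t) & null_set (fun t => B t /\ ~ E t)].
Proof.
move=> mE.
have /choice_fun[G HG] : forall n : nat, exists G, open_R G /\ (forall t, E t -> G t) /\
    outer_le (fun t => G t /\ ~ E t) (n.+1%:R^-1).
  by move=> n; apply: mE; apply/RltP; rewrite invr_gt0.
exists (\bigcap_n (G n : set RT)); split.
- apply: bigcap_measurable => // n _; apply: open_measurable; apply: open_R_open.
  by have [] := HG n.
- by move=> t Et n _; have [_ [+ _]] := HG n; apply.
- move=> e /RltP e0.
  have [n ne] : exists n : nat, (n.+1%:R^-1 : R) < e.
    exists (Num.truncn e^-1); rewrite invf_plt ?posrE //; exact: truncnS_gt.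
  have [_ [_ H]] := HG n.
  apply: (outer_le_weaken _ _ _ _ _ _ H); last exact/RleP/ltW.
  by move=> t [Gt nEt]; split => //; exact: Gt.
Qed.

(** In dimension zero the set is everything or empty. Otherwise the preimage of a product is the
    intersection of a preimage under the first coordinate with one under the tail, and the latter is
    covered by induction because slab interiors are open. Rational centres and radii make the union
    countable. *)
Lemma measurable_open_coord (n : nat) : forall (U : vec n -> Prop) (z : R -> vec n),
  open_coord U -> (forall i, measurable_fun [set: RT] (fun t : RT => z t i : RT)) ->
  measurable [set t : RT | U (z t)].
Proof.
elim: n => [|n IH] U z oU mz.
  have [Uz|nUz] := pselect (U (z 0)).
    rewrite (_ : mkset _ = setT); first exact: measurableT.
    apply/seteqP; split => // t _ /=.
    have -> : z t = z 0 by apply: functional_extensionality => i; inversion i.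
    by [].
  rewrite (_ : mkset _ = set0); first exact: measurable0.
  apply/seteqP; split => // t /=.
  have -> : z t = z 0 by apply: functional_extensionality => i; inversion i.
  by [].
have -> : [set t : RT | U (z t)] = \bigcup_(q : rat) \bigcup_(d : rat)
    ([set t : RT | (`|(z t Fin.F1 : RT) - ratr q| < ratr d)%R] `&`
     [set t : RT | slab_interior U (ratr q) (ratr d) (vtail (z t))]).
  apply/seteqP; split => t /=.
    move=> /oU[e [/RltP e0 He]].
    (* The centre [q] is chosen within [d] of the first coordinate, so with [d < e / 2] the whole
       slab around [q] stays within [e] of it. *)
    have [d /andP[d0 de]] : exists d : rat, 0 < (ratr d : R) < e / 2.
      have /rat_in_itvoo[d] : 0 < e / 2 by rewrite divr_gt0.
      by rewrite in_itv /=; exists d.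
    have [q /andP[q1 q2]] : exists q : rat, z t Fin.F1 < (ratr q : R) < z t Fin.F1 + ratr d.
      have /rat_in_itvoo[q] : z t Fin.F1 < z t Fin.F1 + ratr d by rewrite ltrDl.
      by rewrite in_itv /=; exists q.
    have zq : `|z t Fin.F1 - ratr q| < ratr d.
      by rewrite distrC gtr0_norm ?subr_gt0 // ltrBlDl.
    exists q => //; exists d => //; split => //=.
    exists e; split; first exact/RltP.
    move=> w' Hw' s /RltP; rewrite RabsE => Hs; apply: He.
    rewrite -(vcons_eta (z t)); apply: vcons_close; last exact: Hw'.
    apply/RltP; rewrite RabsE.
    have -> : Rminus s (z t Fin.F1) = (s - ratr q) - (z t Fin.F1 - ratr q).
      by rewrite RminusE opprB addrA subrK.
    apply: (le_lt_trans (ler_normB _ _)).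
    by rewrite (splitr e) ltrD // (lt_trans _ de).
  move=> [q _ [d _ [zq si]]]; rewrite -(vcons_eta (z t)).
  by apply: (slab_interior_self _ _ _ _ _ si); apply/RltP; rewrite RabsE; exact: zq.
apply: bigcupT_measurable_rat => q; apply: bigcupT_measurable_rat => d.
apply: measurableI.
  have mf : measurable_fun [set: RT] (fun t : RT => `|(z t Fin.F1 : RT) - ratr q|).
    apply: measurableT_comp => //; apply: measurable_funB => //; exact: mz.
  have := mf measurableT [set` Interval -oo%O (BLeft (ratr d : RT))] (measurable_itv _).
  by rewrite setTI; congr (measurable _); apply/seteqP; split => t /=; rewrite in_itv.
apply: IH; first exact: slab_interior_open.
by move=> i; exact: mz.
Qed.

(** Time is made a further coordinate, which turns superlevel sets of [F] into preimages of open
    sets in dimension [m + 1]. [Rmax t0 t] keeps the time argument in the range where [F] is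
    continuous. *)
Lemma measurable_jointly_continuous (m : nat) (t0 : R) (F : R -> vec m -> R) (v : R -> vec m) :
  jointly_continuous t0 F -> (forall i, measurable_fun [set: RT] (fun t : RT => v t i : RT)) ->
  measurable_fun [set: RT] (fun t : RT => F (Rmax t0 t) (v t) : RT).
Proof.
move=> /jointly_continuous_coord HF mv.
apply: (measurability _ (RGenOInfty.measurableE RT)).
move=> _ [_ [c ->] <-]; rewrite setTI.
pose U := fun w : vec m.+1 => Rlt c (F (Rmax t0 (w Fin.F1)) (vtail w)).
have oU : open_coord U.
  move=> w Uw.
  have [d [d0 Hd]] := HF (Rmax t0 (w Fin.F1)) (vtail w) (Rmax_l _ _) _ (Rlt_Rminus _ _ Uw).
  exists d; split => // w' Hw'.
  have := Hd (Rmax t0 (w' Fin.F1)) (vtail w') (Rmax_l _ _).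
  have H1 : Rlt (Rabs (Rminus (Rmax t0 (w' Fin.F1)) (Rmax t0 (w Fin.F1)))) d.
    apply: Rle_lt_trans (Hw' Fin.F1).
    by rewrite /Rmax; repeat case: Rle_dec => ?; rewrite /Rabs; repeat case: Rcase_abs => ?; Lra.lra.
  move=> /(_ H1 (fun i => Hw' (Fin.FS i))) /Rabs_def2; rewrite /U; Lra.lra.
have := @measurable_open_coord m.+1 U (fun t => vcons t (v t)) oU.
have mc i : measurable_fun [set: RT] (fun t : RT => vcons t (v t) i : RT).
  apply: (@Fin.caseS' m i (fun i => measurable_fun [set: RT] (fun t : RT => vcons t (v t) i : RT))).
    exact: measurable_id.
  by move=> j; exact: mv.
move=> /(_ mc); congr (measurable _); apply/seteqP; split => t /=;
  rewrite in_itv /= andbT.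
- by move=> ?; apply/RltP.
- by move=> ?; apply/RltP.
Qed.

(** The input is Lebesgue measurable and essentially bounded; composition with continuous functions
    and integration are carried out with a Borel function that is truly bounded on compact
    intervals. The superlevel sets of the coordinates at rational levels are replaced by Borel
    hulls. All the excesses and the exceptional sets of the bounds lie in one measurable null set
    [Z], and [v] is [u] off [Z] from [tsharp] on and zero elsewhere. *)
Lemma borel_representative (m : nat) (tsharp : R) (u : R -> vec m) :
  admissible_input tsharp u ->
  exists v : R -> vec m, [/\ forall i, measurable_fun [set: RT] (fun t : RT => v t i : RT),
    null_set (fun t => Rle tsharp t /\ v t <> u t) &
    forall b, exists M, forall t, Rle tsharp t /\ Rle t b -> Rle (norm (v t)) M].
Proof.
move=> [mu_ bu].
have mE (i : Fin.t m) (q : rat) : measurable_set (fun t => inJ tsharp t /\ Rlt (ratr q) (u t i)).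
  apply: (mu_ (fun w => Rlt (ratr q) (w i))) => w Hw.
  exists (Rminus (w i) (ratr q)); split; first Lra.lra.
  move=> w' Hw'; have := Rle_lt_trans _ _ _ (coord_le_norm _ (vsub w' w) i) Hw'.
  by move/Rabs_def2; rewrite /vsub; Lra.lra.
have /choice_fun[B HB] : forall i : Fin.t m, exists B : rat -> set RT, forall q,
    [/\ measurable (B q), (forall t, inJ tsharp t /\ Rlt (ratr q) (u t i) -> B q t) &
    null_set (fun t => B q t /\ ~ (inJ tsharp t /\ Rlt (ratr q) (u t i)))].
  by move=> i; exact: (choice_fun _ (fun q => measurable_set_borel (mE i q))).
have /choice_fun[M /choice_fun[N HN]] : forall k : nat, exists M N, null_set N /\
    forall t, Rle tsharp t /\ Rle t k%:R -> ~ N t -> Rle (norm (u t)) M.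
  by move=> k; exact: bu.
have nZ : null_set (fun t =>
   (exists i n, exists2 q : rat, unpickle n = Some q &
      B i q t /\ ~ (inJ tsharp t /\ Rlt (ratr q) (u t i))) \/ exists k, N k t).
  apply: null_set_union; last by apply: null_set_bigcup => k; have [] := HN k.
  apply: null_set_fin => i; apply: null_set_bigcup => n.
  case E : (unpickle n) => [q|].
    have [_ _] := HB i q; apply: null_set_incl => t [q' [<-]]; exact.
  by apply: null_set_incl null_set_empty => t [].
have /null_setE[Z [mZ Z0 subZ]] := nZ.
pose D : set RT := ~` Z `&` [set t | tsharp <= t].
have mD : measurable D.
  apply: measurableI; first exact: measurableC.
  have := measurable_itv (Interval (BLeft (tsharp : RT)) +oo%O).
  by congr (measurable _); apply/seteqP; split => t /=; rewrite in_itv /= andbT.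
exists (fun t i => (((fun s : RT => u s i : RT) \_ D) t)); split.
- move=> i; apply/(measurable_restrictT _ _).1 => //.
  apply: (measurability _ (RGenOInfty.measurableE RT)) => _ [_ [c ->] <-].
  (* On [D] the hulls agree with the superlevel sets they contain, and every real level is exhausted
     by the rational levels above it. *)
  have -> : D `&` (fun s : RT => u s i : RT) @^-1` [set` Interval (BRight c) +oo%O] =
      D `&` \bigcup_(q : rat) (if c < ratr q then B i q else set0).
    apply/seteqP; split => t /= [Dt].
    + rewrite in_itv /= andbT => /rat_in_itvoo[q]; rewrite in_itv /= => /andP[cq qu].
      split => //; exists q => //; rewrite cq; have [_ + _] := HB i q; apply.
      by split; [case: Dt => _ /= /RleP|exact/RltP].
    + move=> [q _]; case: ifPn => // cq Bt; split => //; rewrite in_itv /= andbT.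
      apply: (lt_trans cq); apply/RltP; apply: NNPP => nu.
      case: Dt => /= + _; apply; apply: subZ; left.
      exists i, (pickle q); exists q; first by rewrite pickleK.
      by split => // -[].
  apply: measurableI => //; apply: bigcupT_measurable_rat => q.
  by case: ifP => _; [have [] := HB i q|exact: measurable0].
- have nZ' : null_set Z by apply/null_setE; exists Z; split.
  apply: (null_set_incl _ _ _ nZ').
  move=> t [st vu]; apply: NNPP => nZt; apply: vu.
  apply: functional_extensionality => i; rewrite patchE mem_set //; split => //=.
  exact/RleP.
- move=> b.
  pose k := (Num.truncn `|b|).+1.
  exists (Rmax (M k) 0) => t [st tb].
  have [Dt|nDt] := pselect (D t).
  + have -> : (fun i => ((fun s : RT => u s i : RT) \_ D) t) = u t.
      by apply: functional_extensionality => i; rewrite patchE mem_set.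
    apply: Rle_trans (Rmax_l _ _); have [_] := HN k; apply.
      split => //; apply: (Rle_trans _ _ _ tb); apply/RleP.
      apply: (le_trans (ler_norm _)); exact/ltW/truncnS_gt.
    by move=> Nt; case: Dt => + _; apply; apply: subZ; right; exists k.
  + have -> : (fun i => ((fun s : RT => u s i : RT) \_ D) t) = fun i => 0.
      by apply: functional_extensionality => i; rewrite patchE memNset.
    apply: Rle_trans (Rmax_r _ _).
    rewrite -[X in Rle _ X](Rmult_0_r (INR m)); apply: norm_le_coords => i.
    by rewrite Rabs_R0; exact: Rle_refl.
Qed.

Lemma derivable_pt_limE (H : RT -> RT) (t l : RT) :
  derivable H t 1 -> derive1 H t = l -> derivable_pt_lim H t l.
Proof.
move=> dH <- e /RltP e0.
have : h^-1 *: (H (h + t) - H t) @[h --> 0^'] --> derive1 H t.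
  move: dH; rewrite /derivable /derive1.
  have -> : (fun h : RT => h^-1 *: ((H \o shift t) (h *: (1 : RT)) - H t)) =
            (fun h : RT => h^-1 *: (H (h + t) - H t)).
    by apply: functional_extensionality => h /=; rewrite /GRing.scale /= mulr1.
  by [].
move=> /cvgrPdist_lt /(_ e e0) /nbhs_ballP[d /= d0 Hd].
have d0' : Rlt 0 d by apply/RltP.
exists (mkposreal d d0') => h h0 /RltP hd.
have := Hd h; rewrite /ball /= sub0r normrN => /(_ hd (introN eqP h0)).
rewrite distrC => K; apply/RltP; rewrite RabsE; move: K.
by rewrite RdivE !RminusE RplusE mulrC (addrC t h).
Qed.

(** The primitive is that of [F] along the Borel representative. The times at which this differs
    from [u] enlarge the exceptional set and leave the derivative [F t (u t)] elsewhere. *)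
Lemma caratheodory_primitive (m : nat) (tsharp t0 : R) (u : R -> vec m) (F : R -> vec m -> R) :
  admissible_input tsharp u -> Rle tsharp t0 -> jointly_continuous t0 F ->
  exists H : R -> R, H t0 = IZR 0 /\
    (forall b, exists C, Rle 0 C /\ forall r s, (Rle t0 r /\ Rle r b) -> (Rle t0 s /\ Rle s b) ->
      Rle (Rabs (Rminus (H s) (H r))) (Rmult C (Rabs (Rminus s r)))) /\
    exists N, null_set N /\ forall t, Rlt t0 t -> ~ N t -> derivable_pt_lim H t (F t (u t)).
Proof.
move=> Hu Ht0 HF.
have [v [mv nv bv]] := borel_representative Hu.
have mh := measurable_jointly_continuous HF mv.
have [|H [Ha HL [A [mA A0 sA]]]] := @lebesgue_primitive RT _ t0 mh.
  move=> b; have [M HM] := bv b.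
  have [C HC] := jointly_continuous_bounded t0 F b M HF.
  exists C => t /andP[/RleP t0t /RleP tb]; rewrite -RabsE; apply/RleP.
  rewrite Rmax_right //; apply: HC => //; apply: HM; split => //.
  exact: Rle_trans t0t.
exists H; split => //; split.
- move=> b; have [C HC] := HL b.
  exists (Rabs C); split; first exact: Rabs_pos.
  have Hrs r s : Rle t0 r -> Rle r s -> Rle s b ->
      Rle (Rabs (Rminus (H s) (H r))) (Rmult (Rabs C) (Rabs (Rminus s r))).
    move=> /RleP h1 /RleP h2 /RleP h3; apply/RleP.
    rewrite !RabsE; apply: (le_trans (HC r s h1 h2 h3)).
    rewrite [`|Rminus s r|]ger0_norm ?subr_ge0 // RmultE ler_wpM2r ?subr_ge0 //.
    exact: ler_norm.
  move=> r s [r1 r2] [s1 s2]; have [rs|sr] := Rle_lt_dec r s; first exact: Hrs.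
  rewrite Rabs_minus_sym (Rabs_minus_sym s); apply: Hrs => //; exact: Rlt_le.
- exists (fun t => A t \/ (Rle tsharp t /\ v t <> u t)); split.
    by apply: null_set_union => //; apply/null_setE; exists A; split.
  move=> t tt nAt.
  have ts : Rle tsharp t by apply: (Rle_trans _ _ _ Ht0); exact: Rlt_le.
  have vu : v t = u t by apply: NNPP => h; apply: nAt; right.
  have : t0 < t -> derivable H t 1 /\ derive1 H t = F (Rmax t0 t) (v t).
    by apply: NNPP => h; apply: nAt; left; apply: sA.
  have /RltP tt' := tt.
  move=> /(_ tt')[d e].
  have := derivable_pt_limE d e.
  by rewrite vu Rmax_right //; exact: Rlt_le.
Qed.

End Lebesgue.

(** * Picard iteration *)

Definition lip_on {n} (x : R -> vec n) (a b C : R) : Prop :=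
  0 <= C /\ forall r s, a <= r <= b -> a <= s <= b -> norm (vsub (x s) (x r)) <= C * Rabs (s - r).

Lemma lip_on_abs_continuous {n} (x : R -> vec n) a b C : lip_on x a b C -> abs_continuous x a b.
Proof.
intros [HC Hx] e He. exists (e / (C + 1)); split; [apply Rdiv_lt_0_compat; lra|].
intros l Hl _ Hlen.
assert (H : sum_list (fun p => norm (vsub (x (snd p)) (x (fst p)))) l
  <= C * sum_list (fun p => snd p - fst p) l).
{ clear Hlen. induction l as [|p l IH]; simpl; [lra|].
  assert (Hp := Hl p ltac:(now left)).
  assert (K := Hx (fst p) (snd p) ltac:(lra) ltac:(lra)). rewrite Rabs_right in K by lra.
  assert (IH' := IH ltac:(intros q Hq; apply Hl; now right)). simpl in IH'. lra. }
change (sum_list (fun p => norm (vsub (x (snd p)) (x (fst p)))) l < e).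
change (sum_list (fun p => snd p - fst p) l < e / (C + 1)) in Hlen.
assert (E : e / (C + 1) * (C + 1) = e) by (field; lra).
assert (Hpos : 0 <= sum_list (fun p => snd p - fst p) l).
{ clear - Hl. induction l as [|p l IH]; simpl; [lra|].
  assert (Hp := Hl p ltac:(now left)).
  assert (IH' := IH ltac:(intros q Hq; apply Hl; now right)). simpl in IH'. lra. }
nra.
Qed.

Lemma norm_vsub_empty (p q : vec 0) : norm (vsub p q) = 0.
Proof. unfold norm, dot; simpl. apply sqrt_0. Qed.

(** The exponential on the right has derivative at least that of both [h] and [- h] almost
    everywhere, so the two differences decrease from [t0] on. *)
Lemma exp_comparison (h : R -> R) (N : R -> Prop) (t0 b C A la : R) :
  0 <= C -> 0 <= A -> 0 <= la -> null_set N -> h t0 = 0 ->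
  (forall r s, t0 <= r <= b -> t0 <= s <= b -> Rabs (h s - h r) <= C * Rabs (s - r)) ->
  (forall t, t0 < t < b -> ~ N t -> exists D, derivable_pt_lim h t D /\
     Rabs D <= A * la * exp (la * (t - t0))) ->
  forall t, t0 <= t <= b -> Rabs (h t) <= A * exp (la * (t - t0)).
Proof.
intros HC HA Hla HN Hh0 Hlip Hder t Ht.
assert (Hone : forall sg, Rabs sg = 1 -> sg * h t <= A * exp (la * (t - t0))).
{ intros sg Hsg.
  assert (K : sg * h t - A * exp (la * (t - t0)) <= sg * h t0 - A * exp (la * (t0 - t0))).
  (* A Lipschitz function needs no trajectory to control its increments: one in dimension zero
     contributes nothing to the bound. *)
  { set (z := fun _ : R => (fun _ => 0) : vec 0).
    apply (ae_monotone_deriv z (fun s => sg * h s - A * exp (la * (s - t0))) N t0 t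
      (C + A * exp (la * (b - t0)) * la)); try lra; auto.
    - assert (0 < exp (la * (b - t0))) by apply exp_pos.
      apply Rplus_le_le_0_compat; auto. repeat apply Rmult_le_pos; lra.
    - apply lip_on_abs_continuous with 0. split; [lra|]. intros. rewrite norm_vsub_empty. lra.
    - intros q Hq. exists 1; split; [lra|]. intros s Hs _. rewrite norm_vsub_empty, Rplus_0_r.
      replace (sg * h s - A * exp (la * (s - t0)) - (sg * h q - A * exp (la * (q - t0))))
        with (sg * (h s - h q) + - (A * (exp (la * (s - t0)) - exp (la * (q - t0))))) by ring.
      eapply Rle_trans; [apply Rabs_triang|]. rewrite Rabs_Ropp, !Rabs_mult, Hsg, (Rabs_right A) by lra.
      assert (L1 := Hlip q s ltac:(lra) ltac:(lra)).
      assert (L2 := exp_lipschitz (la * (b - t0)) (la * (s - t0)) (la * (q - t0))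
        ltac:(apply Rmult_le_compat_l; lra) ltac:(apply Rmult_le_compat_l; lra)).
      replace (la * (s - t0) - la * (q - t0)) with (la * (s - q)) in L2 by ring.
      rewrite Rabs_mult, (Rabs_right la) in L2 by lra.
      assert (A * Rabs (exp (la * (s - t0)) - exp (la * (q - t0)))
        <= A * (exp (la * (b - t0)) * (la * Rabs (s - q)))) by now apply Rmult_le_compat_l.
      lra.
    - intros s Hs HNs. destruct (Hder s ltac:(lra) HNs) as [D [HD HDb]].
      exists (sg * D - A * (exp (la * (s - t0)) * (la * (1 - 0)))). split.
      + assert (sg * D <= Rabs D).
        { eapply Rle_trans; [apply Rle_abs|]. rewrite Rabs_mult, Hsg; lra. }
        lra.
      + apply derivable_pt_lim_minus; [now apply derivable_pt_lim_scal|].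
        apply derivable_pt_lim_scal.
        apply (derivable_pt_lim_comp (fun s => la * (s - t0)) exp); [|apply derivable_pt_lim_exp].
        apply derivable_pt_lim_scal.
        apply derivable_pt_lim_minus; [apply derivable_pt_lim_id|apply derivable_pt_lim_const]. }
  rewrite Hh0 in K. replace (la * (t0 - t0)) with 0 in K by ring. rewrite exp_0 in K. lra. }
assert (H1 := Hone 1 ltac:(apply Rabs_R1)).
assert (H2 := Hone (-1) ltac:(rewrite Rabs_left; lra)).
apply Rabs_le; lra.
Qed.

Lemma geometric_increments (a : nat -> R) (B : R) :
  (forall k, Rabs (a (S k) - a k) <= B * (/ 2) ^ k) ->
  forall k p, Rabs (a (k + p)%nat - a k) <= 2 * B * (/ 2) ^ k.
Proof.
intros H k p.
assert (HB : 0 <= B) by (generalize (H 0%nat) (Rabs_pos (a 1%nat - a 0%nat)); simpl; lra).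
assert (Hk : 0 < (/ 2) ^ k) by (apply pow_lt; lra).
(* The induction carries the exact partial sum of the geometric series. *)
assert (K : Rabs (a (k + p)%nat - a k) <= 2 * B * (/ 2) ^ k * (1 - (/ 2) ^ p)).
{ induction p as [|p IH].
  - rewrite Nat.add_0_r, Rminus_diag_eq, Rabs_R0 by auto. simpl; lra.
  - replace (k + S p)%nat with (S (k + p)) by lia.
    replace (a (S (k + p)) - a k) with ((a (S (k + p)) - a (k + p)%nat) + (a (k + p)%nat - a k)) by ring.
    eapply Rle_trans; [apply Rabs_triang|].
    specialize (H (k + p)%nat). rewrite pow_add in H. simpl. lra. }
assert (0 < (/ 2) ^ p) by (apply pow_lt; lra).
assert (0 <= 2 * B * (/ 2) ^ k) by (repeat apply Rmult_le_pos; lra).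
nra.
Qed.

Lemma half_pow_small (B e : R) : 0 < e -> exists k, B * (/ 2) ^ k < e.
Proof.
intros He. destruct (pow_lt_1_zero (/ 2) ltac:(rewrite Rabs_right; lra) (e / (Rabs B + 1))) as [k Hk].
{ apply Rdiv_lt_0_compat; auto. generalize (Rabs_pos B); lra. }
exists k. specialize (Hk k (Nat.le_refl k)). assert (P : 0 < (/ 2) ^ k) by (apply pow_lt; lra).
rewrite Rabs_right in Hk by lra.
assert (E : e / (Rabs B + 1) * (Rabs B + 1) = e) by (field; generalize (Rabs_pos B); lra).
generalize (Rle_abs B) (Rabs_pos B). nra.
Qed.

Lemma geometric_limit (a : nat -> R) (B : R) :
  (forall k, Rabs (a (S k) - a k) <= B * (/ 2) ^ k) ->
  exists l, Un_cv a l /\ forall k, Rabs (a k - l) <= 2 * B * (/ 2) ^ k.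
Proof.
intros H. assert (G := geometric_increments a B H).
destruct (R_complete a) as [l Hl].
{ intros e He. destruct (half_pow_small (4 * B) e He) as [K HK]. exists K.
  intros p q Hp Hq. unfold Rdist.
  assert (G1 := G K (p - K)%nat). assert (G2 := G K (q - K)%nat).
  replace (K + (p - K))%nat with p in G1 by lia. replace (K + (q - K))%nat with q in G2 by lia.
  replace (a p - a q) with ((a p - a K) - (a q - a K)) by ring.
  eapply Rle_lt_trans; [apply Rabs_triang|]. rewrite Rabs_Ropp. lra. }
exists l; split; auto. intros k. apply Rnot_lt_le; intros Hlt.
destruct (Hl (Rabs (a k - l) - 2 * B * (/ 2) ^ k) ltac:(lra)) as [K HK].
specialize (HK (k + K)%nat ltac:(lia)). unfold Rdist in HK. specialize (G k K).
assert (T := Rabs_triang (a k - a (k + K)%nat) (a (k + K)%nat - l)).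
rewrite (Rabs_minus_sym (a k)) in T.
replace (a k - a (k + K)%nat + (a (k + K)%nat - l)) with (a k - l) in T by ring. lra.
Qed.

Definition cont_from {n} (t0 : R) (x : R -> vec n) : Prop :=
  forall t, t0 <= t -> forall e, 0 < e -> exists d, 0 < d /\
    forall s, t0 <= s -> Rabs (s - t) < d -> norm (vsub (x s) (x t)) < e.

Definition loc_lip {n} (t0 : R) (x : R -> vec n) : Prop := forall b, exists C, lip_on x t0 b C.

Lemma loc_lip_cont_from {n} t0 (x : R -> vec n) : loc_lip t0 x -> cont_from t0 x.
Proof.
intros Hx t Ht e He. destruct (Hx (t + 1)) as [C [HC H]].
assert (P : 0 < e / (C + 1)) by (apply Rdiv_lt_0_compat; lra).
exists (Rmin 1 (e / (C + 1))); split; [apply Rmin_glb_lt; lra|].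
intros s Hs Hst. generalize (Rmin_l 1 (e / (C + 1))) (Rmin_r 1 (e / (C + 1))); intros.
assert (K : Rabs (s - t) < 1) by lra. apply Rabs_def2 in K.
specialize (H t s ltac:(lra) ltac:(lra)).
assert (E : e / (C + 1) * (C + 1) = e) by (field; lra).
generalize (Rabs_pos (s - t)); nra.
Qed.

Lemma vsub_coord_le {n} (x y : vec n) i : Rabs (x i - y i) <= norm (vsub x y).
Proof. apply (coord_le_norm n (vsub x y) i). Qed.

Definition ae_deriv {n} (t0 : R) (y : R -> vec n) (v : R -> vec n) : Prop :=
  exists N, null_set N /\ forall t, t0 < t -> ~ N t ->
    forall i, derivable_pt_lim (fun s => y s i) t (v t i).

(** With [x] fixed and continuous, each component of [g] becomes a jointly continuous function of
    time and input, to which the scalar result applies; this is one step of the iteration. *)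
Lemma vector_primitive {n m} (tsharp t0 : R) (u : R -> vec m) (g : R -> vec n -> vec m -> vec n)
  (x : R -> vec n) (x0 : vec n) :
  admissible_input tsharp u -> tsharp <= t0 -> f_continuous t0 g -> cont_from t0 x ->
  exists y, y t0 = x0 /\ loc_lip t0 y /\ ae_deriv t0 y (fun t => g t (x t) (u t)).
Proof.
intros Hu Ht0 Hg Hx.
assert (HF : forall i, jointly_continuous t0 (fun t w => g t (x t) w i)).
{ intros i t w Ht e He. destruct (Hg t (x t) w Ht e He) as [d [Hd H]].
  destruct (Hx t Ht d Hd) as [d' [Hd' H']].
  exists (Rmin d d'); split; [now apply Rmin_glb_lt|].
  generalize (Rmin_l d d') (Rmin_r d d'); intros K1 K2 t' w' Ht' H1 H2.
  eapply Rle_lt_trans; [apply vsub_coord_le|]. apply H; auto; try lra. apply H'; auto; lra. }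
destruct (choice_fun _ (fun i => Lebesgue.caratheodory_primitive Hu Ht0 (HF i))) as [H HH].
exists (fun t i => x0 i + H i t). split; [|split].
- apply functional_extensionality; intros i. destruct (HH i) as [-> _]. ring.
- intros b. destruct (fin_common_bound n (fun i C => 0 <= C /\ forall r s, t0 <= r <= b ->
    t0 <= s <= b -> Rabs (H i s - H i r) <= C * Rabs (s - r))) as [C HC].
  + intros i c c' Hc [H1 H2]; split; [lra|]. intros r s Hr Hs. specialize (H2 r s Hr Hs).
    generalize (Rabs_pos (s - r)); nra.
  + intros i. destruct (HH i) as [_ [K _]]. apply K.
  + exists (INR n * Rmax 0 C). split; [apply Rmult_le_pos; [apply pos_INR|apply Rmax_l]|].
    intros r s Hr Hs. rewrite Rmult_assoc. apply norm_le_coords. intros i. unfold vsub.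
    replace (x0 i + H i s - (x0 i + H i r)) with (H i s - H i r) by ring.
    destruct (HC i) as [_ K]. eapply Rle_trans; [apply K; auto|].
    apply Rmult_le_compat_r; [apply Rabs_pos|apply Rmax_r].
- assert (HN : forall i, exists N, null_set N /\ forall t, t0 < t -> ~ N t ->
      derivable_pt_lim (H i) t (g t (x t) (u t) i)) by (intros i; apply HH).
  destruct (choice_fun _ HN) as [N HN'].
  exists (fun t => exists i, N i t). split; [apply null_set_fin; intros i; apply HN'|].
  intros t Ht HNt i. rewrite <- (Rplus_0_l (g t (x t) (u t) i)).
  apply derivable_pt_lim_plus; [apply derivable_pt_lim_const|].
  apply HN'; auto. intros Hi; apply HNt; now exists i.
Qed.

(** The passage from derivatives to functions divides the coefficient of the exponential weight by
    [la]; the contraction of the iteration rests on this gain. *)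
Lemma primitive_comparison {n} (t0 b A la : R) (y y' v v' : R -> vec n) :
  loc_lip t0 y -> loc_lip t0 y' -> y t0 = y' t0 -> ae_deriv t0 y v -> ae_deriv t0 y' v' ->
  0 <= A -> 0 <= la ->
  (exists N, null_set N /\ forall t, t0 < t < b -> ~ N t ->
     norm (vsub (v t) (v' t)) <= A * la * exp (la * (t - t0))) ->
  forall t i, t0 <= t <= b -> Rabs (y t i - y' t i) <= A * exp (la * (t - t0)).
Proof.
intros Hy Hy' H0 [N [HN Hd]] [N' [HN' Hd']] HA Hla [N'' [HN'' Hv]] t i Ht.
destruct (Hy b) as [C [HC HL]]. destruct (Hy' b) as [C' [HC' HL']].
apply (exp_comparison (fun s => y s i - y' s i) (fun t => N t \/ (N' t \/ N'' t)) t0 b (C + C'));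
  auto; [lra|repeat apply null_set_union; auto|rewrite H0; ring| |].
- intros r s Hr Hs.
  replace (y s i - y' s i - (y r i - y' r i)) with ((y s i - y r i) + - (y' s i - y' r i)) by ring.
  eapply Rle_trans; [apply Rabs_triang|]. rewrite Rabs_Ropp.
  assert (K1 := vsub_coord_le (y s) (y r) i). assert (K2 := vsub_coord_le (y' s) (y' r) i).
  specialize (HL r s Hr Hs); specialize (HL' r s Hr Hs). lra.
- intros s Hs HNs. exists (v s i - v' s i). split.
  + apply derivable_pt_lim_minus; [apply Hd|apply Hd']; tauto || lra.
  + eapply Rle_trans; [apply vsub_coord_le|]. apply Hv; tauto.
Qed.

(* With [la = 2 n L], Bielecki's weight [exp (la (t - t0))] halves the distance of successive
   iterates on all of [t0, b] at once. *)
Lemma picard {n m} (tsharp t0 : R) (u : R -> vec m) (g : R -> vec n -> vec m -> vec n) (x0 : vec n) :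
  admissible_input tsharp u -> tsharp <= t0 -> f_continuous t0 g ->
  (forall b, exists L, 0 <= L /\ ae_on (fun t => t0 <= t <= b) (fun t => forall x y,
     norm (vsub (g t x (u t)) (g t y (u t))) <= L * norm (vsub x y))) ->
  exists y, y t0 = x0 /\ loc_lip t0 y /\ ae_deriv t0 y (fun t => g t (y t) (u t)).
Proof.
intros Hu Ht0 Hg HL.
(* Continuity is assumed under the existential quantifier, so that choice gives an operator [Phi]
   defined on all functions. *)
assert (Hstep : forall x : R -> vec n, exists y, cont_from t0 x ->
  y t0 = x0 /\ loc_lip t0 y /\ ae_deriv t0 y (fun t => g t (x t) (u t))).
{ intros x. destruct (classic (cont_from t0 x)) as [Hx|Hx].
  - destruct (vector_primitive tsharp t0 u g x x0 Hu Ht0 Hg Hx) as [y Hy]. now exists y.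
  - now exists x. }
destruct (choice_fun _ Hstep) as [Phi HPhi]. clear Hstep.
set (X := fix X k := match k with O => fun _ : R => x0 | S k => Phi (X k) end).
assert (HX0 : loc_lip t0 (X 0%nat)).
{ intros b. exists 0; split; [lra|]. intros. simpl. rewrite norm_vsub_self; lra. }
assert (HX : forall k, X k t0 = x0 /\ loc_lip t0 (X k)).
{ induction k as [|k [IH1 IH2]]; [split; auto|].
  destruct (HPhi (X k) (loc_lip_cont_from _ _ IH2)) as [H1 [H2 _]]. split; auto. }
assert (HXd : forall k, ae_deriv t0 (X (S k)) (fun t => g t (X k t) (u t))).
{ intros k. apply HPhi, loc_lip_cont_from, HX. }
assert (Hinc : forall b, exists B, forall k t i, t0 <= t <= b ->
  Rabs (X (S k) t i - X k t i) <= B * (/ 2) ^ k).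
{ intros b. destruct (Rle_lt_dec t0 b) as [Hb|Hb]; [|exists 0; intros; lra].
  destruct (HL b) as [L [HL0 [NL [HNL HLip]]]].
  destruct (proj2 (HX 1%nat) b) as [C [HC HC1]].
  set (la := 2 * (INR n * L)).
  assert (Hla : 0 <= la) by (unfold la; generalize (pos_INR n); nra).
  assert (HA : 0 <= C * (b - t0)) by (apply Rmult_le_pos; lra).
  (* [C] is a Lipschitz constant of the first iterate, which starts at the constant value of iterate
     zero; hence the initial distance is at most [C * (b - t0)]. *)
  assert (K : forall k t i, t0 <= t <= b ->
    Rabs (X (S k) t i - X k t i) <= C * (b - t0) * (/ 2) ^ k * exp (la * (t - t0))).
  { induction k as [|k IH].
    - intros t i Ht. assert (K := HC1 t0 t ltac:(lra) Ht). rewrite (proj1 (HX 1%nat)) in K.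
      assert (K' := vsub_coord_le (X 1%nat t) x0 i). simpl (X 0%nat). rewrite pow_O.
      rewrite Rabs_right in K by lra.
      assert (1 <= exp (la * (t - t0))) by (rewrite <- exp_0; apply exp_le, Rmult_le_pos; lra).
      assert (C * (t - t0) <= C * (b - t0)) by (apply Rmult_le_compat_l; lra). nra.
    - apply (primitive_comparison t0 b (C * (b - t0) * (/ 2) ^ S k) la (X (S (S k))) (X (S k))
        (fun t => g t (X (S k) t) (u t)) (fun t => g t (X k t) (u t))); auto; try apply HX.
      + now rewrite (proj1 (HX (S (S k)))), (proj1 (HX (S k))).
      + apply Rmult_le_pos; auto. apply pow_le; lra.
      + exists NL; split; auto. intros t Ht HNt.
        eapply Rle_trans; [apply HLip; auto; lra|].
        assert (Kn := norm_le_coords n (vsub (X (S k) t) (X k t)) _ (fun i => IH t i ltac:(lra))).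
        apply Rmult_le_compat_l with (r := L) in Kn; auto.
        unfold la in *. simpl pow in *. lra. }
  exists (C * (b - t0) * exp (la * (b - t0))). intros k t i Ht.
  eapply Rle_trans; [apply K; auto|].
  assert (exp (la * (t - t0)) <= exp (la * (b - t0))) by (apply exp_le, Rmult_le_compat_l; lra).
  assert (0 < (/ 2) ^ k) by (apply pow_lt; lra).
  rewrite Rmult_assoc, (Rmult_comm ((/ 2) ^ k)), <- Rmult_assoc. apply Rmult_le_compat_r; [lra|].
  now apply Rmult_le_compat_l. }
assert (Hlim : forall ti : R * Fin.t n, exists l, t0 <= fst ti -> Un_cv (fun k => X k (fst ti) (snd ti)) l).
{ intros [t i]; simpl. destruct (Rle_lt_dec t0 t) as [Ht|Ht]; [|exists 0; intros; lra].
  destruct (Hinc t) as [B HB].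
  destruct (geometric_limit (fun k => X k t i) B) as [l [Hl _]]; [intros k; apply HB; lra|].
  now exists l. }
destruct (choice_fun _ Hlim) as [xl Hxl].
set (x := fun t i => xl (t, i)) in *.
assert (Hconv : forall b, exists B, 0 <= B /\ forall k t, t0 <= t <= b ->
  norm (vsub (X k t) (x t)) <= B * (/ 2) ^ k).
{ intros b. destruct (Hinc b) as [B HB]. exists (INR n * (2 * Rmax 0 B)). split.
  { generalize (pos_INR n) (Rmax_l 0 B). intros; apply Rmult_le_pos; lra. }
  intros k t Ht. rewrite Rmult_assoc. apply norm_le_coords. intros i.
  destruct (geometric_limit (fun k => X k t i) B) as [l [Hl Hl']]; [intros k'; apply HB; lra|].
  assert (E : x t i = l) by (apply (UL_sequence _ _ _ (Hxl (t, i) ltac:(simpl; lra)) Hl)).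
  unfold vsub. rewrite E. eapply Rle_trans; [apply Hl'|].
  apply Rmult_le_compat_r; [apply pow_le; lra|]. generalize (Rmax_r 0 B); lra. }
assert (Hx : cont_from t0 x).
{ intros t Ht e He. destruct (Hconv (t + 1)) as [B [_ HB]].
  destruct (half_pow_small B (e / 3) ltac:(lra)) as [k Hk].
  destruct (loc_lip_cont_from _ _ (proj2 (HX k)) t Ht (e / 3) ltac:(lra)) as [d [Hd H]].
  exists (Rmin 1 d); split; [apply Rmin_glb_lt; lra|]. intros s Hs Hst.
  generalize (Rmin_l 1 d) (Rmin_r 1 d); intros.
  assert (K : Rabs (s - t) < 1) by lra. apply Rabs_def2 in K.
  assert (K1 := HB k s ltac:(lra)). assert (K2 := HB k t ltac:(lra)).
  assert (K3 := H s Hs ltac:(lra)). rewrite norm_vsub_sym in K1.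
  assert (T1 := norm_triangle n (x s) (X k s) (x t)).
  assert (T2 := norm_triangle n (X k s) (X k t) (x t)). lra. }
(* The limit [x] is so far only continuous. A further application of [Phi] gives a function with the
   required regularity, which is shown to equal [x] from [t0] on; before [t0] the values of [x] are
   arbitrary. *)
destruct (HPhi x Hx) as [Hy0 [Hylip Hyd]]. set (y := Phi x) in *.
assert (Hxy : forall t, t0 <= t -> x t = y t).
{ intros t Ht. apply functional_extensionality; intros i.
  destruct (HL t) as [L [HL0 [NL [HNL HLip]]]]. destruct (Hconv t) as [B [HB0 HB]].
  (* The rate [1] is an arbitrary choice: [x] and the iterates are already close, and the bound
     vanishes as [k] grows. *)
  assert (Hcmp : forall k, Rabs (y t i - X (S k) t i) <= L * (B * (/ 2) ^ k) * exp (1 * (t - t0))).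
  { intros k.
    assert (Pk : 0 < (/ 2) ^ k) by (apply pow_lt; lra).
    apply (primitive_comparison t0 t (L * (B * (/ 2) ^ k)) 1 y (X (S k))
      (fun s => g s (x s) (u s)) (fun s => g s (X k s) (u s))); auto; try apply HX; try lra.
    - now rewrite (proj1 (HX (S k))).
    - repeat apply Rmult_le_pos; lra.
    - exists NL; split; auto. intros s Hs HNs. eapply Rle_trans; [apply HLip; auto; lra|].
      rewrite norm_vsub_sym.
      assert (1 <= exp (1 * (s - t0))) by (generalize (exp_ineq1_le (1 * (s - t0))); lra).
      assert (Kb := HB k s ltac:(lra)). apply Rmult_le_compat_l with (r := L) in Kb; auto.
      assert (0 <= L * (B * (/ 2) ^ k)) by (repeat apply Rmult_le_pos; lra). nra. }
  symmetry. apply NNPP; intros Hne.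
  assert (Hpos : 0 < Rabs (y t i - x t i)) by (apply Rabs_pos_lt; lra).
  destruct (half_pow_small (L * B * exp (1 * (t - t0)) + B) _ Hpos) as [k Hk].
  assert (K1 := Hcmp k). assert (K2 := HB (S k) t ltac:(lra)).
  assert (K3 := vsub_coord_le (X (S k) t) (x t) i).
  assert (T := Rabs_triang (y t i - X (S k) t i) (X (S k) t i - x t i)).
  replace (y t i - X (S k) t i + (X (S k) t i - x t i)) with (y t i - x t i) in T by ring.
  assert (Pk : 0 < (/ 2) ^ k) by (apply pow_lt; lra).
  simpl pow in K2. assert (0 <= B * (/ 2) ^ k) by (apply Rmult_le_pos; lra).
  lra. }
exists y. split; [auto|split; [auto|]].
destruct Hyd as [N [HN Hd]]. exists N; split; auto. intros t Ht HNt i.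
rewrite <- (Hxy t) by lra. now apply Hd.
Qed.

(** * Truncation and forward completeness *)

Definition cont_fun (r : R -> R) : Prop :=
  forall t e, 0 < e -> exists d, 0 < d /\ forall s, Rabs (s - t) < d -> Rabs (r s - r t) < e.

(** The [k]-th ramp rises from [0] at [k - 2] to [1] at [k - 1]. At time [t] only the terms with
    [k < t + 2] are nonzero, so the sum is locally finite, and the ramp of [k = up t], which is at
    most [t + 1], is complete. *)
Lemma continuous_majorant (B : nat -> R) : (forall k, 0 <= B k) ->
  exists r : R -> R, cont_fun r /\ (forall t, 0 <= r t) /\
    forall t, 0 <= t -> exists k, t <= INR k /\ B k <= r t.
Proof.
intros HB.
set (w := fun t k => B k * clamp 0 1 (t - INR k + 2)).
set (S := fun N t => sum_f_R0 (w t) N).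
assert (Hw : forall t k, 0 <= w t k).
{ intros t k. apply Rmult_le_pos; auto. apply clamp_bounds; lra. }
assert (Hstab : forall t N p, t + 2 <= INR N -> S (N + p)%nat t = S N t).
{ intros t N p HN. induction p as [|p IH]; [now rewrite Nat.add_0_r|].
  replace (N + Datatypes.S p)%nat with (Datatypes.S (N + p)) by lia. unfold S in *. simpl. rewrite IH.
  replace (w t (Datatypes.S (N + p))) with 0; [ring|]. unfold w.
  assert (INR N <= INR (Datatypes.S (N + p))) by (apply le_INR; lia).
  replace (clamp 0 1 (t - INR (Datatypes.S (N + p)) + 2)) with 0; [ring|].
  unfold clamp, Rmax, Rmin; repeat destruct Rle_dec; lra. }
assert (Hlim : forall t, exists l, forall N, t + 2 <= INR N -> S N t = l).
{ intros t. destruct (INR_unbounded (t + 2)) as [N0 HN0]. exists (S N0 t). intros N HN.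
  destruct (Nat.le_ge_cases N0 N) as [H|H].
  - replace N with (N0 + (N - N0))%nat by lia. apply Hstab; lra.
  - replace N0 with (N + (N0 - N))%nat by lia. symmetry; apply Hstab; lra. }
destruct (choice_fun _ Hlim) as [r Hr].
exists r. split; [|split].
(* [t + 3] in place of [t + 2] lets the same [N] serve all times within one of [t]. *)
- intros t e He. destruct (INR_unbounded (t + 3)) as [N HN].
  set (D := sum_f_R0 B N). assert (HD : 0 <= D) by (apply cond_pos_sum; auto).
  assert (P : 0 < e / (D + 1)) by (apply Rdiv_lt_0_compat; lra).
  exists (Rmin 1 (e / (D + 1))); split; [apply Rmin_glb_lt; lra|]. intros s Hs.
  generalize (Rmin_l 1 (e / (D + 1))) (Rmin_r 1 (e / (D + 1))); intros.
  assert (K : Rabs (s - t) < 1) by lra. apply Rabs_def2 in K.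
  rewrite <- (Hr t N) by lra. rewrite <- (Hr s N) by lra.
  assert (L : Rabs (S N s - S N t) <= D * Rabs (s - t)).
  { unfold S, D. rewrite <- minus_sum, Rmult_comm, scal_sum.
    eapply Rle_trans; [apply Rsum_abs|]. apply sum_Rle; intros k _.
    unfold w. rewrite <- Rmult_minus_distr_l, Rabs_mult, (Rabs_right (B k)) by (apply Rle_ge; auto).
    apply Rmult_le_compat_l; auto. eapply Rle_trans; [apply clamp_lip|]. right; f_equal; ring. }
  assert (E : e / (D + 1) * (D + 1) = e) by (field; lra).
  generalize (Rabs_pos (s - t)); nra.
- intros t. destruct (INR_unbounded (t + 2)) as [N HN]. rewrite <- (Hr t N) by lra.
  apply cond_pos_sum; auto.
- intros t Ht. destruct (archimed t) as [A1 A2].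
  assert (Hup : (0 <= up t)%Z) by (apply le_IZR; lra).
  set (k := Z.to_nat (up t)).
  assert (Ek : INR k = IZR (up t)) by (unfold k; rewrite INR_IZR_INZ, Z2Nat.id; auto).
  exists k; split; [lra|].
  destruct (INR_unbounded (t + 2)) as [N HN]. rewrite <- (Hr t N) by lra.
  replace (B k) with (w t k).
  + apply sum_f_R0_ge_term; auto. apply INR_le. lra.
  + unfold w. replace (clamp 0 1 (t - INR k + 2)) with 1; [ring|].
    unfold clamp, Rmax, Rmin; repeat destruct Rle_dec; lra.
Qed.

(** Clamping each coordinate has Lipschitz constant [1] in the Euclidean norm and fixes the
    Euclidean ball of radius [r]; its image is bounded by [n] times [r]. *)
Definition vclamp {n} (r : R) (x : vec n) : vec n := fun i => clamp (- r) r (x i).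

Lemma clamp_radius_lip r r' t : 0 <= r -> 0 <= r' ->
  Rabs (clamp (- r') r' t - clamp (- r) r t) <= Rabs (r' - r).
Proof.
intros Hr Hr'. unfold clamp, Rmax, Rmin; repeat destruct Rle_dec; unfold Rabs; repeat destruct Rcase_abs; lra.
Qed.

Lemma norm_mono_coords {n} (x y : vec n) : (forall i, Rabs (x i) <= Rabs (y i)) -> norm x <= norm y.
Proof.
intros H. apply sqrt_le_1_alt, finsum_le. intros i.
change (Rsqr (x i) <= Rsqr (y i)). now apply Rsqr_le_abs_1.
Qed.

Lemma vclamp_lip {n} r (x y : vec n) : norm (vsub (vclamp r x) (vclamp r y)) <= norm (vsub x y).
Proof. apply norm_mono_coords; intros i. apply clamp_lip. Qed.

Lemma vclamp_norm {n} r (x : vec n) : 0 <= r -> norm (vclamp r x) <= INR n * r.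
Proof.
intros Hr. apply norm_le_coords; intros i. apply Rabs_le. apply clamp_bounds; lra.
Qed.

Lemma vclamp_id {n} r (x : vec n) : norm x <= r -> vclamp r x = x.
Proof.
intros H. apply functional_extensionality; intros i. apply clamp_id.
apply Rabs_le_between. eapply Rle_trans; [apply coord_le_norm|auto].
Qed.

Lemma truncation_continuous {n m} tsharp t0 (f : R -> vec n -> vec m -> vec n) (r : R -> R) :
  tsharp <= t0 -> f_continuous tsharp f -> cont_fun r -> (forall t, 0 <= r t) ->
  f_continuous t0 (fun t x w => f t (vclamp (r t) x) w).
Proof.
unfold f_continuous, inJ. intros Ht0 Hf Hr Hr0 t x u Ht e He.
destruct (Hf t (vclamp (r t) x) u ltac:(lra) e He) as [d [Hd H]].
assert (Hn : 0 < 2 * (INR n + 1)) by (generalize (pos_INR n); lra).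
destruct (Hr t (d / (2 * (INR n + 1))) ltac:(now apply Rdiv_lt_0_compat)) as [d' [Hd' H']].
exists (Rmin d' (d / 2)); split; [apply Rmin_glb_lt; lra|].
generalize (Rmin_l d' (d / 2)) (Rmin_r d' (d / 2)); intros K1 K2 t' x' u' Ht' H1 H2 H3.
apply H; try lra.
assert (T := norm_triangle n (vclamp (r t') x') (vclamp (r t') x) (vclamp (r t) x)).
assert (T1 := vclamp_lip (r t') x' x).
assert (T2 : norm (vsub (vclamp (r t') x) (vclamp (r t) x)) <= INR n * Rabs (r t' - r t)).
{ apply norm_le_coords; intros i. now apply clamp_radius_lip. }
specialize (H' t' ltac:(lra)).
assert (E : d / (2 * (INR n + 1)) * (2 * (INR n + 1)) = d) by (field; generalize (pos_INR n); lra).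
generalize (pos_INR n) (Rabs_pos (r t' - r t)); nra.
Qed.

Lemma cont_fun_bounded r a b : cont_fun r -> exists C, forall t, a <= t <= b -> r t <= C.
Proof.
intros Hr. destruct (Rle_lt_dec a b) as [Hab|Hab]; [|exists 0; intros; lra].
apply (cousin (fun p q => exists C, forall t, p <= t <= q -> r t <= C) a b Hab).
- intros p q s _ _ [C1 H1] [C2 H2]. exists (Rmax C1 C2). intros t Ht.
  destruct (Rle_lt_dec t q).
  + eapply Rle_trans; [apply H1; lra|apply Rmax_l].
  + eapply Rle_trans; [apply H2; lra|apply Rmax_r].
- intros t _. destruct (Hr t 1 ltac:(lra)) as [d [Hd H]]. exists d; split; auto.
  intros p q _ Hp Hq _ Hpq. exists (r t + 1). intros s Hs.
  assert (K := H s ltac:(apply Rabs_def1; lra)). apply Rabs_def2 in K. lra.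
Qed.

(** On a compact time interval the truncated states lie in one ball and the input is essentially
    bounded, so a single local Lipschitz constant of [f] serves all states. *)
Lemma truncation_lipschitz {n m} tsharp t0 (f : R -> vec n -> vec m -> vec n) (r : R -> R)
  (u : R -> vec m) : tsharp <= t0 -> f_loc_lipschitz tsharp f -> loc_ess_bounded tsharp u ->
  cont_fun r -> (forall t, 0 <= r t) ->
  forall b, exists L, 0 <= L /\ ae_on (fun t => t0 <= t <= b) (fun t => forall x y,
     norm (vsub (f t (vclamp (r t) x) (u t)) (f t (vclamp (r t) y) (u t))) <= L * norm (vsub x y)).
Proof.
intros Ht0 Hf Hu Hr Hr0 b.
destruct (Hu b) as [M [N [HN HM]]].
destruct (cont_fun_bounded r t0 b Hr) as [C HC].
destruct (Hf b (INR n * C) M) as [L HL].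
exists (Rmax 0 L); split; [apply Rmax_l|]. exists N; split; auto.
intros t Ht HNt x y.
assert (Hb : forall z : vec n, norm (vclamp (r t) z) <= INR n * C).
{ intros z. eapply Rle_trans; [apply vclamp_norm; auto|].
  apply Rmult_le_compat_l; [apply pos_INR|auto]. }
eapply Rle_trans; [apply HL; auto; [lra|apply HM; auto; lra]|].
apply Rle_trans with (Rmax 0 L * norm (vsub (vclamp (r t) x) (vclamp (r t) y))).
- apply Rmult_le_compat_r; [apply norm_nonneg|apply Rmax_r].
- apply Rmult_le_compat_l; [apply Rmax_l|apply vclamp_lip].
Qed.

(** At the supremum of the times up to which [D <= 0], a value [D <= -1] would let continuity
    prolong that range. The conclusion [-1 < D t] is the form that contradicts a margin of one. *)
Lemma first_exit (D : R -> R) (a b : R) : a <= b ->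
  (forall t, a <= t <= b -> forall e, 0 < e -> exists d, 0 < d /\
    forall s, a <= s <= b -> Rabs (s - t) < d -> Rabs (D s - D t) < e) ->
  D a <= -1 -> 0 < D b ->
  exists t, a <= t <= b /\ -1 < D t /\ forall s, a <= s < t -> D s <= 0.
Proof.
intros Hab Hc Ha Hb.
destruct (completeness (fun t => a <= t <= b /\ forall s, a <= s <= t -> D s <= 0)) as [m [Hub Hlub]].
{ exists b; intros t [Ht _]; lra. }
{ exists a; split; [lra|]. intros s Hs. replace s with a by lra. lra. }
assert (Hm1 : a <= m).
{ apply Hub. split; [lra|]. intros s Hs. replace s with a by lra. lra. }
assert (Hm2 : m <= b) by (apply Hlub; intros t [Ht _]; lra).
assert (Hbelow : forall s, a <= s < m -> D s <= 0).
{ intros s Hs. apply NNPP; intros Hn. assert (m <= s); [|lra].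
  apply Hlub. intros t [Ht Ht']. apply Rnot_lt_le; intros Hlt. apply Hn, Ht'. lra. }
exists m; repeat split; auto. apply Rnot_le_lt; intros Hle.
destruct (Hc m ltac:(lra) 1 ltac:(lra)) as [d [Hd H]].
assert (Hmb : m < b) by (destruct Hm2 as [|E]; [auto|subst; lra]).
set (q := Rmin b (m + d / 2)).
assert (Hq : m < q /\ q <= b /\ q <= m + d / 2).
{ unfold q; repeat split; [apply Rmin_glb_lt; lra|apply Rmin_l|apply Rmin_r]. }
assert (q <= m); [|lra]. apply Hub. split; [lra|]. intros s Hs.
destruct (Rlt_le_dec s m); [apply Hbelow; lra|].
assert (K := H s ltac:(lra) ltac:(apply Rabs_def1; lra)). apply Rabs_def2 in K. lra.
Qed.

Theorem theorem3 (n m : nat) (tsharp : R) (f : R -> vec n -> vec m -> vec n)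
  (Hfc : f_continuous tsharp f) (Hfl : f_loc_lipschitz tsharp f) (Hf0 : f_zero tsharp f)
  (V : R -> vec n -> R) (Vt : R -> vec n -> R) (Vx : R -> vec n -> vec n)
  (a1 a2 rho mu : R -> R)
  (HV : C1_with_partials tsharp V Vt Vx)
  (HVpos : forall t x, inJ tsharp t -> 0 <= V t x)
  (Ha1 : classKinf a1) (Ha2 : classKinf a2) (Hrho : classK rho)
  (Hmu_pc : piecewise_continuous tsharp mu) (Hmu : UES tsharp mu)
  (Hsand : forall t x, inJ tsharp t -> a1 (norm x) <= V t x <= a2 (norm x))
  (Hdiss : forall t x u, inJ tsharp t -> rho (norm u) <= V t x ->
     Vt t x + dot (Vx t x) (f t x u) <= mu t * V t x) :
  exists (sigma : R -> R -> R) (gamma1 : R -> R),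
    classKL sigma /\ classK gamma1 /\
    (* forward completeness: every initial state has a solution on [t0, oo) *)
    (forall u, admissible_input tsharp u -> forall t0 (x0 : vec n), inJ tsharp t0 ->
       exists x, x t0 = x0 /\ forall T, t0 < T -> is_solution tsharp f u x t0 T) /\
    (* ISS estimate, with ||u||_[t0,t] <= M *)
    (forall u, admissible_input tsharp u ->
       forall x t0 T, is_solution tsharp f u x t0 T ->
       forall t M, t0 <= t < T -> (forall s, t0 <= s <= t -> norm (u s) <= M) ->
       norm (x t) <= sigma (norm (x t0)) (t - t0) + gamma1 M).
Proof.
destruct Hmu as [alpha [beta [Halpha [Hbeta Hues]]]].
destruct (classKinf_inverse a1 Ha1) as [g [Hg Hginv]].
assert (Ha2' := classKinf_classK a2 Ha2).
set (sigma := fun s t => g (2 * exp (beta - alpha * t) * a2 s)).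
set (gamma := fun M => g (2 * exp beta * rho M)).
assert (Hsigma : classKL sigma) by now apply classKL_exp.
assert (Hgamma : classK gamma).
{ apply classK_comp_scal; auto. generalize (exp_pos beta); lra. }
(* The input bound is required off a null set, so that the same estimate serves the essential bounds
   in the existence proof and the pointwise bounds in the final claim. *)
assert (Hbound : forall (u : R -> vec m) x t0 t1 M N,
  tsharp <= t0 -> t0 <= t1 -> 0 <= M -> abs_continuous x t0 t1 -> null_set N ->
  (forall t, t0 < t < t1 -> ~ N t ->
     (forall i, derivable_pt_lim (fun s => x s i) t (f t (x t) (u t) i)) /\ norm (u t) <= M) ->
  norm (x t1) <= sigma (norm (x t0)) (t1 - t0) + gamma M).
{ intros u x t0 t1 M N H0 H1 HM Hac HN Hsol.
  assert (K := iss_core tsharp f V Vt Vx rho mu alpha beta HV HVpos Hrho Hmu_pc Hues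
    ltac:(lra) Hdiss u x t0 t1 M N H0 H1 HM Hac HN Hsol).
  destruct (Hsand t1 (x t1)) as [S1 _]; [unfold inJ; lra|].
  destruct (Hsand t0 (x t0)) as [_ S2]; [unfold inJ; lra|].
  set (c := exp (beta - alpha * (t1 - t0))) in *.
  assert (Pc : 0 < c) by apply exp_pos. assert (Pb : 0 < exp beta) by apply exp_pos.
  assert (Hr : 0 <= rho M) by now apply Hrho.
  assert (Ha : 0 <= a2 (norm (x t0))) by (apply Ha2'; apply norm_nonneg).
  apply Rle_trans with (g (c * a2 (norm (x t0)) + exp beta * rho M)).
  - apply Hginv; [apply norm_nonneg|]. apply Rmult_le_compat_l with (r := c) in S2; lra.
  - unfold sigma, gamma. fold c. rewrite !(Rmult_assoc 2).
    apply classK_sum_le; auto; apply Rmult_le_pos; lra. }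
exists sigma, gamma. split; [auto|split; [auto|split]].
- intros u Hu t0 x0 Ht0. unfold inJ in Ht0. destruct Hu as [Hum Hub].
  assert (HM : forall k : nat, exists M, 0 <= M /\ exists N, null_set N /\
    forall t, tsharp <= t <= t0 + INR k -> ~ N t -> norm (u t) <= M).
  { intros k. destruct (Hub (t0 + INR k)) as [M [N [HN H]]]. exists (Rmax 0 M).
    split; [apply Rmax_l|]. exists N; split; auto. intros t Ht HNt.
    eapply Rle_trans; [now apply H|apply Rmax_r]. }
  destruct (choice_fun _ HM) as [M HM'].
  assert (Hg0 : forall y, 0 <= y -> 0 <= g y) by apply Hg.
  assert (Hs0 : 0 <= sigma (norm x0) 0).
  { apply Hg0. assert (0 <= a2 (norm x0)) by (apply Ha2'; apply norm_nonneg).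
    generalize (exp_pos (beta - alpha * 0)). intros. repeat apply Rmult_le_pos; lra. }
  (* The value at [k] is the estimate for elapsed times up to [k] with the decay of [sigma] ignored,
     plus the margin of one. *)
  destruct (continuous_majorant (fun k => sigma (norm x0) 0 + gamma (M k) + 1)) as [r [Hr [Hr0 Hr1]]].
  { intros k. destruct (HM' k) as [Hk _]. assert (0 <= gamma (M k)) by now apply Hgamma. lra. }
  set (r' := fun t => r (t - t0)).
  assert (Hr' : cont_fun r').
  { intros t e He. destruct (Hr (t - t0) e He) as [d [Hd H]]. exists d; split; auto.
    intros s Hs. apply H. replace (s - t0 - (t - t0)) with (s - t) by ring. auto. }
  assert (Hr0' : forall t, 0 <= r' t) by (intros; apply Hr0).
  destruct (picard tsharp t0 u (fun t x w => f t (vclamp (r' t) x) w) x0 (conj Hum Hub) Ht0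
    (truncation_continuous tsharp t0 f r' Ht0 Hfc Hr' Hr0')
    (truncation_lipschitz tsharp t0 f r' u Ht0 Hfl Hub Hr' Hr0'))
    as [x [Hx0 [Hxlip [N [HN Hxd]]]]].
  assert (Hac : forall b, abs_continuous x t0 b).
  { intros b. destruct (Hxlip b) as [C HC]. now apply lip_on_abs_continuous with C. }
  (* As long as the truncation is inactive the estimate keeps [x] a unit below its threshold. *)
  assert (Hin : forall t, t0 <= t -> (forall s, t0 <= s < t -> norm (x s) <= r' s) ->
    norm (x t) - r' t <= -1).
  { intros t Ht Hbelow. destruct (Hr1 (t - t0) ltac:(lra)) as [k [Hk HBk]].
    destruct (HM' k) as [HMk [Nk [HNk Huk]]].
    (* Strictly before [t] the truncated field agrees with [f] along [x]; the estimate uses the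
       equation in the open interval only and can thus be read at [t] itself. *)
    assert (K : norm (x t) <= sigma (norm (x t0)) (t - t0) + gamma (M k)).
    { apply (Hbound u x t0 t (M k) (fun s => N s \/ Nk s)); auto; [now apply null_set_union|].
      intros s Hs HNs. split.
      - intros i. assert (D := Hxd s ltac:(lra) ltac:(tauto) i). cbv beta in D.
        rewrite (vclamp_id (r' s)) in D; auto. apply Hbelow; lra.
      - apply Huk; [lra|tauto]. }
    rewrite Hx0 in K.
    assert (sigma (norm x0) (t - t0) <= sigma (norm x0) 0).
    { destruct Hsigma as [_ [Hmono _]]. apply Hmono; [apply norm_nonneg|lra|lra]. }
    unfold r'. lra. }
  assert (Hall : forall t, t0 <= t -> norm (x t) <= r' t).
  { intros t Ht. apply Rnot_lt_le; intros Hlt.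
    destruct (first_exit (fun s => norm (x s) - r' s) t0 t Ht) as [q [Hq [Hq1 Hq2]]].
    - intros s Hs e He.
      destruct (abs_continuous_cont_on x t0 t (Hac t) s Hs (e / 2) ltac:(lra)) as [d [Hd H]].
      destruct (Hr' s (e / 2) ltac:(lra)) as [d' [Hd' H']].
      exists (Rmin d d'); split; [now apply Rmin_glb_lt|]. intros p Hp Hps.
      generalize (Rmin_l d d') (Rmin_r d d'); intros.
      specialize (H p Hp ltac:(lra)). specialize (H' p ltac:(lra)).
      assert (K := norm_diff_le n (x p) (x s)).
      replace (norm (x p) - r' p - (norm (x s) - r' s)) with
        ((norm (x p) - norm (x s)) + - (r' p - r' s)) by ring.
      eapply Rle_lt_trans; [apply Rabs_triang|]. rewrite Rabs_Ropp. lra.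
    - apply Hin; [lra|intros; lra].
    - lra.
    - assert (K := Hin q ltac:(lra)). cbv beta in Hq1, Hq2.
      assert (norm (x q) - r' q <= -1); [|lra]. apply K. intros s Hs. specialize (Hq2 s Hs). lra. }
  exists x. split; auto. intros T HT. split; [auto|split; [auto|split]].
  + intros b _. apply Hac.
  (* At [t0] the iteration gives no two-sided derivative, so this point is added to the null set. *)
  + exists (fun t => N t \/ t = t0). split; [apply null_set_union; auto; apply null_set_point|].
    intros t Ht HNt i.
    assert (t <> t0) by tauto.
    assert (D := Hxd t ltac:(lra) ltac:(tauto) i). cbv beta in D.
    rewrite (vclamp_id (r' t)) in D; auto. apply Hall; lra.
- intros u Hu x t0 T [Ht0 [HT [Hac [N [HN Hd]]]]] t M Ht HuM.
  apply (Hbound u x t0 t M N); auto; try lra.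
  + generalize (norm_nonneg m (u t0)) (HuM t0 ltac:(lra)); lra.
  + intros s Hs HNs. split; [apply Hd; auto; lra|apply HuM; lra].
Qed.
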